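(* Let $\mathfrak{F}$ be a Fraïssé class of finite relational structures and let $m$ be an odd positive integer. Suppose that $\mathfrak{F}$ has only finitely many minimal marked structures up to isomorphism, and that for every $X\in\mathfrak{F}$ the order of $\mathrm{Aut}(X)$ divides some power of $m$. Then $\mathfrak{F}$ admits a regular measure (valued in $\mathbf{C}$) if and only if $\mathfrak{F}$ is odd.
   Context: Structures: fix a relational signature; a structure is a finite set with relations of the given arities. An embedding is an injective map that preserves and reflects all relations; subsets carry the induced structure. Given embeddings $i\colon X\to Y$, $j\colon X\to X'$ in a class $\mathfrak{F}$, an amalgamation of $Y$ and $X'$ over $X$ is a structure $Y'\in\mathfrak{F}$ with embeddings $i'\colon X'\to Y'$, $j'\colon Y\to Y'$ such that $i'j=j'i$ and $Y'=\mathrm{im}(i')\cup\mathrm{im}(j')$; amalgamations are considered (and counted) up to the evident notion of isomorphism. $\mathfrak{F}$ is a Fraïssé class if (1) it has finitely many isomorphism classes of $n$-element structures for each $n$; (2) it is hereditary (if $X\in\mathfrak{F}$ and $Y$ embeds in $X$ then $Y\in\mathfrak{F}$); (3) for any embeddings $i\colon X\to Y$ and $j\colon X\to X'$ with $X,Y,X'\in\mathfrak{F}$, at least one amalgamation of $Y$ and $X'$ over $X$ exists. Marked structures: for $X\in\mathfrak{F}$ and disjoint subsets $A,B\subset X$, say $A$ and $B$ are separated if $X$ (with the inclusion maps) is the unique amalgamation of $X\setminus A$ and $X\setminus B$ over $X\setminus(A\cup B)$. Two distinct points are separated if the corresponding singletons are. A marked structure is a pair $(X,x)$ with $X\in\mathfrak{F}$,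 $x\in X$. An element $y\ne x$ of $X$ is extraneous if it is separated from $x$. $(X,x)$ is minimal if it has no extraneous elements. Measures: a measure on $\mathfrak{F}$ valued in a commutative ring $k$ assigns to each embedding $i\colon X\to Y$ in $\mathfrak{F}$ an element $\mu(i)\in k$ such that (i) $\mu(i)=1$ if $i$ is an isomorphism; (ii) $\mu(j\circ i)=\mu(j)\mu(i)$ for composable embeddings; (iii) for embeddings $i\colon X\to Y$, $j\colon X\to X'$ with amalgamations $(Y'_\alpha,i'_\alpha,j'_\alpha)$, $1\le\alpha\le s$ (where $i'_\alpha\colon X'\to Y'_\alpha$), one has $\mu(i)=\sum_\alpha\mu(i'_\alpha)$. The measure is regular if $\mu(i)$ is a unit of $k$ for every embedding $i$. $\mathfrak{F}$ is odd if whenever $X\subset Y$ and $X\subset Z$ are inclusions of structures in $\mathfrak{F}$, the number of amalgamations of $Y$ and $Z$ over $X$ is odd. *)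

(* Defs.v *)
From HB Require Import structures.
From mathcomp Require Import all_boot all_order all_fingroup all_algebra.
From mathcomp Require Import boolp reals complex.

Set Implicit Arguments.
Unset Strict Implicit.
Unset Printing Implicit Defensive.

Import GRing.Theory.
Local Open Scope ring_scope.

Record signature := Signature { symbol :> Type; arity : symbol -> nat }.

Record struct (S : signature) := Struct {
  carrier :> finType;
  interp : forall r : S, pred ((arity r).-tuple carrier) }.

(* Maps between structures are finite functions, so that extensionally equal
   maps are equal. *)
Section Maps.
Variable S : signature.
Implicit Types X Y Z : struct S.

Definition embedding X Y (f : {ffun X -> Y}) : Prop :=
  injective f /\
  forall (r : S) (t : (arity r).-tuple X), interp (map_tuple f t) = interp t.

Definition isomorphism X Y (f : {ffun X -> Y}) : Prop :=
  embedding f /\ bijective f.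

Definition isomorphic X Y : Prop := exists f : {ffun X -> Y}, isomorphism f.

Definition compf X Y Z (g : {ffun Y -> Z}) (f : {ffun X -> Y}) : {ffun X -> Z} :=
  [ffun x => g (f x)].

Definition automorphisms X : {set {perm X}} :=
  [set s : {perm X} | `[< embedding [ffun x => s x] >]].

Definition induced X (A : {set X}) : struct S :=
  @Struct S {x : X | x \in A} (fun r t => interp (map_tuple val t)).

Definition incl X (A : {set X}) : {ffun induced A -> X} := [ffun u => val u].

Definition incl_sub X (A B : {set X}) (sAB : A \subset B) :
    {ffun induced A -> induced B} :=
  [ffun u : {x : X | x \in A} => exist _ (val u) (subsetP sAB _ (valP u))].

End Maps.

Section Classes.
Variables (T : Type) (P : T -> Prop) (iso : T -> T -> Prop).

Definition finitely_many_classes : Prop :=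
  exists (n : nat) (s : 'I_n -> T),
    forall x, P x -> exists a, iso x (s a).

(* s lists each isomorphism class of objects satisfying P exactly once. *)
Definition representatives n (s : 'I_n -> T) : Prop :=
  [/\ forall a, P (s a),
      forall a b, iso (s a) (s b) -> a = b
    & forall x, P x -> exists a, iso x (s a)].

End Classes.

Section Amalgamations.
Variables (S : signature) (F : struct S -> Prop).
Implicit Types X Y Z : struct S.

Record cocone (Y X' : struct S) := Cocone {
  apex :> struct S;
  inX' : {ffun X' -> apex};
  inY : {ffun Y -> apex} }.

Definition cocone_iso Y X' (c d : cocone Y X') : Prop :=
  exists h : {ffun c -> d},
    [/\ isomorphism h, compf h (inX' c) = inX' d & compf h (inY c) = inY d].

Definition amalgamation X Y X' (i : {ffun X -> Y}) (j : {ffun X -> X'})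
    (c : cocone Y X') : Prop :=
  [/\ F c, embedding (inX' c), embedding (inY c),
      compf (inX' c) j = compf (inY c) i
    & forall z : c, z \in codom (inX' c) \/ z \in codom (inY c)].

Definition amalgamations X Y X' (i : {ffun X -> Y}) (j : {ffun X -> X'})
    n (c : 'I_n -> cocone Y X') : Prop :=
  representatives (amalgamation i j) (@cocone_iso Y X') c.

Definition fraisse : Prop :=
  [/\ forall n : nat,
        finitely_many_classes (fun X => F X /\ #|X| = n) (@isomorphic S),
      forall X Y (f : {ffun Y -> X}), F X -> embedding f -> F Y
    & forall X Y X' (i : {ffun X -> Y}) (j : {ffun X -> X'}),
        F X -> F Y -> F X' -> embedding i -> embedding j ->
        exists c, amalgamation i j c].

Definition odd_class : Prop :=
  forall X Y Z (i : {ffun X -> Y}) (j : {ffun X -> Z}),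
    F X -> F Y -> F Z -> embedding i -> embedding j ->
    exists (n : nat) (c : 'I_n -> cocone Y Z), amalgamations i j c /\ odd n.

End Amalgamations.

Section Marked.
Variables (S : signature) (F : struct S -> Prop).

Lemma compl_subl (T : finType) (A B : {set T}) : ~: (A :|: B) \subset ~: A.
Proof. by rewrite setCS subsetUl. Qed.

Lemma compl_subr (T : finType) (A B : {set T}) : ~: (A :|: B) \subset ~: B.
Proof. by rewrite setCS subsetUr. Qed.

Definition separated (X : struct S) (A B : {set X}) : Prop :=
  let i := incl_sub (compl_subl A B) in
  let j := incl_sub (compl_subr A B) in
  let c := Cocone (incl (~: B)) (incl (~: A)) in
  [/\ [disjoint A & B], amalgamation F i j c
    & forall d, amalgamation F i j d -> cocone_iso d c].

Record marked := Marked { marked_struct :> struct S; mark : marked_struct }.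

Definition marked_iso (M N : marked) : Prop :=
  exists2 f : {ffun M -> N}, isomorphism f & f (mark M) = mark N.

Definition extraneous (M : marked) (y : M) : Prop :=
  y != mark M /\ separated [set y] [set mark M].

Definition minimal_marked (M : marked) : Prop :=
  F M /\ forall y : M, ~ extraneous y.

End Marked.

Section Measures.
Variables (S : signature) (F : struct S -> Prop).
Implicit Types X Y Z : struct S.

(* Only the values of mu on embeddings between members of F are meaningful;
   its values on other maps are unconstrained. *)
Definition measure (k : comPzRingType)
    (mu : forall X Y, {ffun X -> Y} -> k) : Prop :=
  [/\ forall X Y (i : {ffun X -> Y}),
        F X -> F Y -> isomorphism i -> mu X Y i = 1,
      forall X Y Z (i : {ffun X -> Y}) (j : {ffun Y -> Z}),
        F X -> F Y -> F Z -> embedding i -> embedding j ->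
        mu X Z (compf j i) = mu Y Z j * mu X Y i
    & forall X Y X' (i : {ffun X -> Y}) (j : {ffun X -> X'}),
        F X -> F Y -> F X' -> embedding i -> embedding j ->
        forall n (c : 'I_n -> cocone Y X'), amalgamations F i j c ->
        mu X Y i = \sum_(a < n) mu X' (c a) (inX' (c a))].

Definition regular (k : comUnitRingType)
    (mu : forall X Y, {ffun X -> Y} -> k) : Prop :=
  forall X Y (i : {ffun X -> Y}),
    F X -> F Y -> embedding i -> mu X Y i \is a GRing.unit.

End Measures.

(* Main.v *)
(* Idea. If Aut(X) has odd order for all X in F, swapping the two factors acts
   freely on the non-diagonal amalgamations of Y with itself over X. With
   D(i) = sum of mu(X -> W) over these amalgamations W, one has
   mu(i)^2 = mu(i) + D(i) for a measure mu, and D(i) is twice a sum of values.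

   Odd => regular. The constant 1 is a measure modulo 2. If an integer-valued mu
   is a measure modulo an even N, then mu^2 - D is one modulo 2N: this is the ghost
   map W_2(Z/N) -> Z/2N, and pairing off the summands under the swap is what gains
   the factor 2. Iterating yields a measure with odd values in a domain of
   characteristic 0. Every measure is generated by its finitely many values on
   minimal marked structures, so this one can be specialized to C with all values
   nonzero.

   Regular => odd. Take a valuation ring A of C in which 2 is not a unit, and among
   the generating values one, x, of least valuation. In x^2 - x = D, the sum D is 2
   times a sum of products of at most two generators; dividing by x^2 shows x in A,
   so all values are in A. Dividing mu(i)^2 = mu(i) + D(i) by mu(i) shows that all
   values are 1 modulo 2A, so additivity counts amalgamations modulo 2. *)
From HB Require Import structures.
From mathcomp Require Import all_boot all_order all_fingroup all_algebra.
From mathcomp Require Import finmap boolp classical_sets functions cardinality.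
From mathcomp Require Import fsbigop filter reals complex.
From mathcomp Require Import cyclic ring_quotient zify ring.
Require Import Defs.

Set Implicit Arguments.
Unset Strict Implicit.
Unset Printing Implicit Defensive.

Import GRing.Theory Num.Theory.
Local Open Scope classical_set_scope.
Local Open Scope ring_scope.


(** * Specialization of finitely generated domains *)

(** Sums over amalgamations run over isomorphism classes, and the swap has to act on the index set
    of such a sum as an honest involution. Therefore a structure generated by a fixed finite index
    set is replaced by its code, the equality and the relations pulled back to the index set.
    Isomorphism respecting the generators becomes equality of codes, restriction becomes pulling
    back, and an iterated amalgamation is a code on a larger index set, so that double sums are
    regrouped by fibres.

    In the doubling step, congruences modulo N have to produce congruences modulo 2N. Each
    discrepancy is arranged as a sum of multiples of N over a set on which the swap acts freely and
    preserves the terms, so that equal errors come in pairs.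

    Since finitely many values generate all others, a homomorphism to C is needed only on a finitely
    generated subring of the limit ring, and nonvanishing of all values reduces to that of one
    product. *)

Section Specialization.
Variables (L : idomainType) (C : numClosedFieldType).

(** Homomorphisms to [C] from the image of [e] are encoded as homomorphisms on [A] that kill the
    kernel of [e], so the image never has to be made a ring. The property is a Nullstellensatz: each
    nonzero element of the image is nonzero at some [C]-point. *)
Definition specializes (A : idomainType) (e : {rmorphism A -> L}) : Prop :=
  forall g, e g != 0 -> exists phi : {rmorphism A -> C},
    (forall f, e f = 0 -> phi f = 0) /\ phi g != 0.

Lemma exists_nonroot (p : {poly C}) : p != 0 -> exists x, ~~ root p x.
Proof.
move=> p0; have /closed_nonrootP [x xP] := p0.
by exists x.
Qed.

Section Step.
Variables (A : idomainType) (e : {rmorphism A -> L}) (x : L).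

Definition eval_ext : {poly A} -> L := horner_eval x \o map_poly e.
HB.instance Definition _ := GRing.RMorphism.on eval_ext.

Lemma eval_extE p : eval_ext p = (map_poly e p).[x].
Proof. by []. Qed.

Lemma eval_extC c : eval_ext c%:P = e c.
Proof. by rewrite eval_extE map_polyC hornerC. Qed.

(* Pseudo-division needs a leading coefficient that [e] does not kill. *)
Lemma trunc_lead (q : {poly A}) : map_poly e q != 0 ->
  exists q', [/\ map_poly e q' = map_poly e q, size q' = size (map_poly e q)
    & e (lead_coef q') != 0].
Proof.
move=> q0; set d := size (map_poly e q).
have d0 : (0 < d)%N by rewrite size_poly_gt0.
pose q' := \poly_(i < d) q`_i.
have Eq : map_poly e q' = map_poly e q.
  apply/polyP => i; rewrite !coef_map coef_poly /=; case: ltnP => // di.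
  by rewrite rmorph0 -coef_map nth_default.
have c0 : e q`_d.-1 != 0.
  by rewrite -coef_map -[_`__]/(lead_coef _) lead_coef_eq0.
have sq : size q' = d.
  by apply: size_poly_eq; apply: contraNneq c0 => ->; rewrite rmorph0.
exists q'; split => //.
by rewrite /lead_coef sq coef_poly prednK // leqnn.
Qed.

Lemma map_lead_neq0 (q : {poly A}) : e (lead_coef q) != 0 ->
  map_poly e q != 0 /\ size (map_poly e q) = size q.
Proof.
move=> h; have sq : size (map_poly e q) = size q by rewrite size_poly_eq.
split=> //; rewrite -size_poly_eq0 sq size_poly_eq0.
by apply: contraNneq h => ->; rewrite lead_coef0 rmorph0.
Qed.

Lemma eval_ext_edivp (p q : {poly A}) :
  e (lead_coef q) ^+ scalp p q * eval_ext p =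
  eval_ext (p %/ q) * eval_ext q + eval_ext (p %% q).
Proof.
rewrite -rmorphXn -eval_extC -!rmorphM -rmorphD /=.
by rewrite mul_polyC Pdiv.Idomain.divp_eq.
Qed.

Lemma size_map_poly_leq (q : {poly A}) : (size (map_poly e q) <= size q)%N.
Proof. exact: size_poly. Qed.

(** If [x] is transcendental over the image of [e], a map [phi] that keeps one coefficient of [g]
    extends by any [y] that is not a root of [phi g]. If [x] is algebraic, it has to go to a root
    [y] of [phi p] for a relation [p] of least degree; writing h(x) g(x) = c with a nonzero constant
    [c] then turns [phi c != 0] into g(y) != 0. *)
Lemma specializes_step : specializes e -> specializes eval_ext.
Proof.
move=> He g g1; have g0 : eval_ext g != 0 by [].
have e0 a : e (lead_coef a) != 0 -> a != 0 :> {poly A}.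
  by apply: contraNneq => ->; rewrite lead_coef0 rmorph0.
have [Halg|Htr] := pselect (exists p, map_poly e p != 0 /\ eval_ext p = 0);
  last first.
  have gm : map_poly e g != 0.
    by apply: contraNneq g0 => h; rewrite eval_extE h horner0.
  have [phi [kphi phig]] : exists phi : {rmorphism A -> C},
      (forall f, e f = 0 -> phi f = 0) /\ phi (g`_(size (map_poly e g)).-1) != 0.
    by apply: He; rewrite -coef_map -[_`__]/(lead_coef _) lead_coef_eq0.
  have /exists_nonroot [y ny] : map_poly phi g != 0.
    by apply: contraNneq phig => h; rewrite -coef_map h coef0.
  exists (horner_eval y \o map_poly phi); split => // f f0 /=.
  have : map_poly e f = 0.
    by apply/eqP/negPn/negP => fm; apply: Htr; exists f.
  move=> /polyP fm; suff -> : map_poly phi f = 0 by rewrite /horner_eval horner0.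
  apply/polyP => i; rewrite coef_map coef0 /=; apply: kphi.
  by move: (fm i); rewrite coef_map coef0.
have [p [pl p0 pmin]] : exists p, [/\ e (lead_coef p) != 0, eval_ext p = 0 &
    forall q, map_poly e q != 0 -> eval_ext q = 0 -> (size p <= size (map_poly e q))%N].
  pose P n := `[< exists p, [/\ map_poly e p != 0, eval_ext p = 0
                 & size (map_poly e p) = n] >].
  have exP : exists n, P n.
    by case: Halg => p [pm p0]; exists (size (map_poly e p)); apply/asboolP; exists p.
  case: (ex_minnP exP) => n /asboolP[p [pm p0 sp]] nmin.
  have [p' [Ep' sp' lp']] := trunc_lead pm.
  exists p'; split => //; first by rewrite eval_extE Ep'.
  move=> q qm q0; rewrite sp' sp; apply: nmin; apply/asboolP; by exists q.
have small (q : {poly A}) : (size q < size p)%N -> eval_ext q = 0 -> map_poly e q = 0.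
  move=> sq q0; apply/eqP/negPn/negP => qm.
  have := leq_trans (pmin _ qm q0) (size_map_poly_leq q).
  by rewrite leqNgt sq.
have sp1 : (1 < size p)%N.
  rewrite ltnNge; apply/negP => sp; move: p0 pl.
  by rewrite [p]size1_polyC // eval_extC lead_coefC => -> /eqP.
(* Among the polynomials whose value at [x] is a nonzero multiple of g(x), one of least degree is
   constant: otherwise dividing [p] by it leaves a smaller one, or factors [p] against the
   minimality of its degree. *)
have [h [c [c0 hgc]]] : exists h c, e c != 0 /\ eval_ext (h * g - c%:P) = 0.
  pose P n := `[< exists q h, [/\ eval_ext q = eval_ext (h * g), eval_ext q != 0,
      (size (map_poly e q) < size p)%N & size (map_poly e q) = n] >].
  have exP : exists n, P n.
    pose r := (g %% p); exists (size (map_poly e r)); apply/asboolP.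
    exists r, ((lead_coef p) ^+ scalp g p)%:P.
    have rE : eval_ext r = eval_ext (((lead_coef p) ^+ scalp g p)%:P * g).
      rewrite rmorphM /= eval_extC rmorphXn /=.
      by rewrite eval_ext_edivp p0 mulr0 add0r.
    split => //.
      by rewrite rE rmorphM /= eval_extC rmorphXn mulf_neq0 ?expf_neq0.
    by rewrite (leq_ltn_trans (size_map_poly_leq _)) // ltn_modp e0.
  case: (ex_minnP exP) => n /asboolP[q1 [h [q1h q10 sq1 sn1]]] nmin.
  have q1m : map_poly e q1 != 0.
    by apply: contraNneq q10 => h0; rewrite eval_extE h0 horner0.
  have [q [Eq sq ql]] := trunc_lead q1m.
  have qE : eval_ext q = eval_ext q1 by rewrite !eval_extE Eq.
  have {q1h} qh : eval_ext q = eval_ext (h * g) by rewrite qE.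
  have {q10} q0 : eval_ext q != 0 by rewrite qE.
  have {nmin} nmin (r h' : {poly A}) : eval_ext r = eval_ext (h' * g) -> eval_ext r != 0 ->
      (size r < size q)%N -> False.
    move=> rh r0 sr.
    have sr' := leq_ltn_trans (size_map_poly_leq r) sr.
    have : P (size (map_poly e r)).
      by apply/asboolP; exists r, h'; split => //; apply: (ltn_trans sr'); rewrite sq.
    by move=> /nmin; rewrite -sn1 -sq leqNgt sr'.
  have q_neq0 := e0 _ ql.
  have [sq1'|sq1'] := leqP (size q) 1.
    move: q0 qh; rewrite [q]size1_polyC // eval_extC => c0 ch.
    by exists h, q`_0; split=> //; rewrite rmorphB /= -ch eval_extC subrr.
  exfalso; have dE := eval_ext_edivp p q; rewrite p0 mulr0 in dE.
  have sr : (size (p %% q)%R < size q)%N by rewrite ltn_modp.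
  have [r0|r0] := eqVneq (eval_ext (p %% q)) 0; last first.
    apply: (nmin _ (- (p %/ q) * h) _ r0 sr).
    rewrite -mulrA rmorphM /= -qh rmorphN mulNr; apply/eqP.
    by rewrite -addr_eq0 addrC -dE.
  have rm : map_poly e (p %% q) = 0.
    by apply: small => //; apply: (ltn_trans sr); rewrite sq.
  have ps : eval_ext (p %/ q) = 0.
    by move: dE; rewrite r0 addr0 => /esym/eqP; rewrite mulf_eq0 (negPf q0) orbF => /eqP.
  have sdm : (size (p %/ q)%R < size p)%N.
    by rewrite size_divp // ltn_subrL -subn1 subn_gt0 sq1' ltnW.
  have dm : map_poly e (p %/ q) = 0 by apply: small.
  have := congr1 (map_poly e) (Pdiv.Idomain.divp_eq p q).
  rewrite rmorphD rmorphM /= dm rm mul0r addr0 map_polyZ /= rmorphXn => /eqP.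
  rewrite -mul_polyC mulf_eq0 polyC_eq0 expf_eq0 (negPf ql) andbF /=.
  by rewrite (negPf (map_lead_neq0 pl).1).
(* Keeping [lead_coef p] alive ensures that [phi p] has a root and that the factor from
   pseudo-division by [p] can be cancelled after [phi]. *)
have [phi [kphi]] : exists phi : {rmorphism A -> C},
    (forall f, e f = 0 -> phi f = 0) /\ phi (lead_coef p * c) != 0.
  by apply: He; rewrite rmorphM mulf_neq0.
rewrite rmorphM mulf_eq0 negb_or => /andP[phil phic].
have sphi : size (map_poly phi p) = size p by rewrite size_poly_eq.
have [y /rootP ry] : exists y, root (map_poly phi p) y.
  by apply/closed_rootP; rewrite sphi neq_ltn sp1 orbT.
have kill f : eval_ext f = 0 -> (map_poly phi f).[y] = 0.
  move=> f0; have := eval_ext_edivp f p.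
  rewrite f0 p0 !mulr0 add0r => /esym r0.
  have rm : map_poly e (f %% p) = 0.
    by apply: small => //; rewrite ltn_modp e0.
  have rphi : map_poly phi (f %% p) = 0.
    apply/polyP => i; rewrite coef_map coef0 /=; apply: kphi.
    by move/polyP: rm => /(_ i); rewrite coef_map coef0.
  have := congr1 (fun q => (map_poly phi q).[y]) (Pdiv.Idomain.divp_eq f p).
  rewrite rmorphD rmorphM /= rphi addr0 hornerM ry mulr0 map_polyZ hornerZ rmorphXn.
  by move/eqP; rewrite mulf_eq0 expf_eq0 (negPf phil) andbF => /eqP.
exists (horner_eval y \o map_poly phi); split => //=.
apply/eqP; rewrite /horner_eval => g0'; move/eqP: phic; apply.
have := kill _ hgc; rewrite rmorphB rmorphM /= hornerD hornerM g0' mulr0 add0r.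
by rewrite map_polyC hornerN hornerC => /eqP; rewrite oppr_eq0 => /eqP.
Qed.

End Step.

(** The elements are adjoined one at a time to the image of [int], which embeds in [L] by hypothesis
    and in [C] by characteristic zero. *)
Theorem specialization (xs : seq L) :
  (forall z : int, z%:~R = 0 :> L -> z = 0) ->
  exists (A : idomainType) (e : {rmorphism A -> L}),
    (forall x, x \in xs -> exists X, e X = x) /\ specializes e.
Proof.
move=> char0; elim: xs => [|x xs [A [e [He se]]]].
  exists int, (GRing.RMorphism.clone _ _ (intmul (1 : L)) _); split => // g g0.
  exists (GRing.RMorphism.clone _ _ (intmul (1 : C)) _); split => //=.
    by move=> f /= /char0 ->.
  by rewrite intr_eq0; apply: contraNneq g0 => ->; rewrite rmorph0.
exists {poly A}, (eval_ext e x : {rmorphism _ -> _}).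
split; last exact: specializes_step.
move=> y; rewrite inE => /predU1P[->|/He[Y <-]].
  by exists 'X; rewrite /= eval_extE map_polyX hornerX.
by exists Y%:P; rewrite /= eval_extC.
Qed.

End Specialization.

(** * Valuation rings in which 2 is not a unit *)

Section TwoAdicValuationRing.
Variable K : numFieldType.
Implicit Types (A : set K) (p q : {poly K}).

Definition is_subring A : Prop :=
  [/\ A 1, forall a b, A a -> A b -> A (a - b)
    & forall a b, A a -> A b -> A (a * b)].

Section SubringTheory.
Variables (A : set K) (sA : is_subring A).

Lemma is_subring0 : A 0.
Proof. by case: sA => A1 AB _; rewrite -(subrr 1); apply: AB. Qed.

Lemma is_subringN a : A a -> A (- a).
Proof. by case: sA => _ AB _ Aa; rewrite -sub0r; apply: AB => //; apply: is_subring0. Qed.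

Lemma is_subringD a b : A a -> A b -> A (a + b).
Proof.
by case: sA => _ AB _ Aa Ab; rewrite -[b]opprK; apply: AB => //; apply: is_subringN.
Qed.

Lemma is_subring_sum I (r : seq I) (P : pred I) (F : I -> K) :
  (forall i, P i -> A (F i)) -> A (\sum_(i <- r | P i) F i).
Proof.
move=> h; apply: (big_ind A) => //; first exact: is_subring0.
exact: is_subringD.
Qed.

Lemma is_subringX a n : A a -> A (a ^+ n).
Proof.
case: sA => A1 _ AM Aa; elim: n => [|n IH]; first by rewrite expr0.
by rewrite exprS; apply: AM.
Qed.

Lemma is_subring_prod (r : seq K) :
  (forall x, x \in r -> A x) -> A (\prod_(x <- r) x).
Proof.
case: sA => A1 _ AM h; rewrite big_seq; apply: (big_ind A) => //.
Qed.

Definition adjoin x : set K :=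
  [set y | exists2 p : {poly K}, (forall i, A p`_i) & y = p.[x]].

Lemma adjoin_subring x : is_subring (adjoin x).
Proof.
case: (sA) => A1 AB AM; split.
- exists 1; last by rewrite hornerC.
  by move=> i; rewrite coef1; case: eqP => // _; apply: is_subring0.
- move=> _ _ [p Ap ->] [q Aq ->]; exists (p - q); last by rewrite hornerD hornerN.
  by move=> i; rewrite coefB; apply: AB.
- move=> _ _ [p Ap ->] [q Aq ->]; exists (p * q); last by rewrite hornerM.
  by move=> i; rewrite coefM; apply: is_subring_sum => j _; apply: AM.
Qed.

Lemma sub_adjoin x : A `<=` adjoin x.
Proof.
move=> a Aa; exists a%:P; last by rewrite hornerC.
by move=> i; rewrite coefC; case: eqP => // _; apply: is_subring0.
Qed.

Lemma mem_adjoin x : adjoin x x.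
Proof.
exists 'X; last by rewrite hornerX.
by case: sA => A1 _ _ i; rewrite coefX; case: eqP => // _; apply: is_subring0.
Qed.

End SubringTheory.

Lemma int_subring : is_subring [set z%:~R | z in [set: int]].
Proof.
split; first by exists 1.
- by move=> _ _ [a _ <-] [b _ <-]; exists (a - b); rewrite ?rmorphB.
- by move=> _ _ [a _ <-] [b _ <-]; exists (a * b); rewrite ?rmorphM.
Qed.

Lemma half_notin_int : ~ [set z%:~R | z in [set: int]] (2^-1 : K).
Proof.
move=> [z _ zE]; have : (z * 2)%:~R = 1%:~R :> K by rewrite rmorphM /= zE mulVf ?pnatr_eq0.
move/intr_inj => /(congr1 absz); rewrite abszM => /(congr1 odd).
by rewrite oddM andbF.
Qed.

Lemma maximal_half_avoiding : exists A, [/\ is_subring A, ~ A 2^-1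
  & forall B, is_subring B -> A `<=` B -> ~ B 2^-1 -> B `<=` A].
Proof.
pose P : set (set K) := [set A | (A = set0 \/ is_subring A) /\ ~ A 2^-1].
have [F FP tot|A [[[A0|sA] nA] Amax]] := @Zorn_bigcup K P.
- split; last by move=> [X FX X2]; case: (FP _ FX) => _; apply.
  have [[X [FX [x Xx]]]|ne] := pselect (exists X, F X /\ X !=set0); last first.
    left; rewrite -subset0 => x [X FX Xx]; apply: ne; exists X; split => //.
    by exists x.
  have sub Y y : F Y -> Y y -> is_subring Y.
    by move=> FY Yy; have [[Y0|//] _] := FP _ FY; rewrite Y0 in Yy.
  have two a b : (\bigcup_(X in F) X) a -> (\bigcup_(X in F) X) b ->
      exists Y, [/\ F Y, is_subring Y, Y a & Y b].
    move=> [Y FY Ya] [Z FZ Zb]; have [h|h] := tot _ _ FY FZ.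
      by exists Z; split => //; [apply: sub Zb|apply: h].
    by exists Y; split => //; [apply: sub Ya|apply: h].
  right; split; first by exists X => //; case: (sub _ _ FX Xx).
  + move=> a b Ua Ub; have [Y [FY [_ YB _] Ya Yb]] := two _ _ Ua Ub.
    by exists Y => //; apply: YB.
  + move=> a b Ua Ub; have [Y [FY [_ _ YM] Ya Yb]] := two _ _ Ua Ub.
    by exists Y => //; apply: YM.
- exfalso; apply: (Amax [set z%:~R | z in [set: int]]).
    rewrite A0 properEneq; split => //.
    by rewrite eq_sym; apply/set0P; exists 1, 1.
  by split; [right; apply: int_subring|apply: half_notin_int].
exists A; split => // B sB AB nB x Bx; apply: contrapT => nAx.
apply: (Amax B); last by split => //; right.
by split => // /(_ x Bx).
Qed.

(** A subring maximal among those avoiding 1/2 works. If it contained neither [x] nor its inverse,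
    adjoining either one would produce 1/2, that is, a polynomial relation in [x] and one in the
    inverse; for relations of least length, the shorter one would shorten the longer. The last
    clause places 2 in the maximal ideal. *)
Theorem valuation_subring : exists A, [/\ is_subring A, ~ A 2^-1,
    forall x, A x \/ A x^-1
  & forall s, A s -> A (1 - 2 * s)^-1].
Proof.
have [A [sA nA Amax]] := maximal_half_avoiding.
have two0 : 2 != 0 :> K by rewrite pnatr_eq0.
have [A1 AB AM] := sA.
have A2 : A 2 by rewrite -[2]/(1 + 1); apply: is_subringD.
have witness x : ~ A x -> exists2 p : {poly K}, (forall i, A p`_i) & p.[x] = 2^-1.
  move=> nx; have [[p Ap ->]|h] := pselect (adjoin A x 2^-1); first by exists p.
  case: nx; apply: (Amax _ (adjoin_subring sA x) (sub_adjoin sA x) h).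
  exact: mem_adjoin.
(* If the inverse of [u] were missing, then 1/2 = p(1/u) for some [p] over [A]. Multiplying by a
   power of [u], which is again of the form 1 - 2t, clears the denominators and leaves 1/2 in
   [A]. *)
have unit s : A s -> A (1 - 2 * s)^-1.
  move=> As; apply: contrapT => /witness[p Ap pE].
  set u := 1 - 2 * s in pE.
  have Au : A u by apply: AB => //; apply: AM.
  have u0 : u != 0.
    apply: contra_notN nA; rewrite subr_eq0 => /eqP h.
    by suff -> : 2^-1 = s by []; apply: (mulfI two0); rewrite mulfV // h.
  have [t At tE] : exists2 t, A t & u ^+ size p = 1 - 2 * t.
    elim: (size p) => [|n [t At tE]];
      first by exists 0; rewrite ?mulr0 ?subr0 //; apply: is_subring0.
    exists (s + u * t); first by apply: is_subringD => //; apply: AM.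
    by rewrite exprS tE mulrBr mulr1 {1}/u mulrDr opprD addrA mulrCA.
  apply: nA; have -> : 2^-1 = t + u ^+ size p * 2^-1.
    by rewrite tE mulrBl mul1r mulrAC mulfV // mul1r addrC subrK.
  apply: is_subringD => //; rewrite -pE horner_coef mulr_sumr.
  apply: is_subring_sum => // i _; rewrite mulrCA; apply: AM => //.
  by rewrite exprVn -expfB ?ltn_ord //; apply: is_subringX.
exists A; split => // x; apply: contrapT => /not_orP[nx nxV].
pose P y n := `[< exists p, [/\ forall i, A p`_i, p.[y] = 2^-1 & size p = n] >].
have exP y : ~ A y -> exists n, P y n.
  by move=> /witness[p Ap pE]; exists (size p); apply/asboolP; exists p.
have : forall y m n, ~ A y -> ~ A y^-1 -> P y m -> P y^-1 n ->
    (forall k, P y k -> (m <= k)%N) -> (n <= m)%N -> False.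
  move=> y m n ny nyV /asboolP[p [Ap pE sp]] /asboolP[q [Aq qE sq]] mmin nm.
  have y0 : y != 0 by apply: contra_notN ny => /eqP->; apply: is_subring0.
  have n1 : (1 < n)%N.
    rewrite ltnNge -sq; apply/negP => s1; apply: nA.
    by rewrite -qE [q]size1_polyC // hornerC.
  have Auv := unit _ (Aq 0%N); set u := 1 - 2 * q`_0 in Auv.
  have u0 : u != 0.
    apply: contra_notN nA; rewrite subr_eq0 => /eqP h.
    by suff -> : 2^-1 = q`_0 by []; apply: (mulfI two0); rewrite mulfV // h.
  (* dividing [q(1/y) = 1/2] by the unit [u] makes [y] integral over [A] *)
  pose r := \poly_(i < n.-1) (2 * u^-1 * q`_(n.-1 - i)).
  have Ar i : A r`_i.
    rewrite coef_poly; case: ifP => _; last exact: is_subring0.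
    by apply: (AM _ _) => //; apply: AM.
  have rE : r.[y] = y ^+ n.-1.
    rewrite horner_poly; move: qE; rewrite horner_coef sq.
    rewrite -(prednK (ltnW n1)) big_ord_recl /= expr0 mulr1 => qE.
    have -> : y ^+ n.-1 =
        u^-1 * 2 * (\sum_(i < n.-1) q`_(bump 0 i) * y^-1 ^+ bump 0 i) * y ^+ n.-1.
      have -> : \sum_(i < n.-1) q`_(bump 0 i) * y^-1 ^+ bump 0 i = 2^-1 - q`_0.
        by rewrite -qE addrC addKr.
      by rewrite -(mulrA u^-1) mulrBr mulfV // mulVf // mul1r.
    rewrite mulr_sumr mulr_suml (reindex_inj rev_ord_inj) /=.
    apply: eq_bigr => i _; rewrite /bump /= add1n subKn // [u^-1 * 2]mulrC -!mulrA.
    congr (_ * (_ * (_ * _))); rewrite mulrC exprVn.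
    have powB a b : (a <= b)%N -> y ^+ (b - a) = y ^+ b / y ^+ a.
      by move=> /subnK{2}<-; rewrite exprD mulfK // expf_neq0.
    exact: powB.
  pose M := 'X^(n.-1) - r.
  have AMi i : A M`_i.
    by rewrite coefB coefXn; apply: AB => //; case: eqP => // _; apply: is_subring0.
  (* [M] is monic of degree [n.-1], at most [m.-1], and vanishes at [y], so this removes the top
     coefficient of [p] without changing the value at [y]. *)
  pose p' := p - p`_m.-1 *: ('X^(m - n) * M).
  have m1 : (1 < m)%N by apply: leq_trans nm.
  have : P y (size p').
    apply/asboolP; exists p'; split => //.
      move=> i; rewrite coefB coefZ; apply: AB => //; apply: AM => //.
      by rewrite coefXnM; case: ifP => // _; apply: is_subring0.
    by rewrite hornerD hornerN hornerZ hornerM hornerD hornerN !hornerXn rE subrr !mulr0 subr0.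
  move=> /mmin; rewrite leqNgt => /negP; apply.
  rewrite -(prednK (ltnW m1)) ltnS; apply/leq_sizeP => j jm.
  have -> : p'`_j = p`_j - p`_m.-1 * (j == m.-1)%:R.
    rewrite coefB coefZ coefXnM ifF; last by lia.
    rewrite coefB coefXn coef_poly ifF; last by lia.
    by rewrite subr0; congr (_ - _ * (nat_of_bool _)%:R); lia.
  have [->|nejm] := eqVneq j m.-1; first by rewrite mulr1 subrr.
  by rewrite mulr0 subr0 nth_default // sp; lia.
move=> key.
case: (ex_minnP (exP _ nx)) => m Pm mmin.
case: (ex_minnP (exP _ nxV)) => n Pn nmin.
have [nm|/ltnW mn] := leqP n m; first exact: (key x m n).
by apply: (key x^-1 n m); rewrite ?invrK.
Qed.

End TwoAdicValuationRing.

(** * A domain of 2-adic limits of integer sequences *)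

Section PrimeQuotient.
Variables (R : comNzRingType) (I : prime_idealr R).

Definition prime_quot := {ideal_quot I}.
HB.instance Definition _ := GRing.ComNzRing.on prime_quot.
Implicit Types x y : prime_quot.

Definition prime_quot_unit : pred prime_quot := fun x => `[< exists y, y * x = 1 >].

(** The default [x] is the value that the unit-ring interface prescribes off the units. *)
Definition prime_quot_inv x : prime_quot := xget x [set y | y * x = 1].

Lemma prime_quot_mulVx : {in prime_quot_unit, left_inverse 1 prime_quot_inv *%R}.
Proof. by move=> x /asboolP[y yx]; rewrite /prime_quot_inv; case: xgetP => [? _ //|/(_ y)]. Qed.

Lemma prime_quot_unitP x y : y * x = 1 -> prime_quot_unit x.
Proof. by move=> yx; apply/asboolP; exists y. Qed.

Lemma prime_quot_inv_out : {in [predC prime_quot_unit], prime_quot_inv =1 id}.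
Proof.
move=> x; rewrite inE => /asboolP nx; rewrite /prime_quot_inv.
by case: xgetP => // y _ yx; case: nx; exists y.
Qed.

HB.instance Definition _ := GRing.ComNzRing_hasMulInverse.Build prime_quot
  prime_quot_mulVx prime_quot_unitP prime_quot_inv_out.

HB.instance Definition _ := GRing.ComUnitRing_isIntegral.Build prime_quot
  (@Quotient.rquot_IdomainAxiom R I).

Definition prime_pi : R -> prime_quot := \pi_({ideal_quot I})%qT.
HB.instance Definition _ := GRing.RMorphism.on prime_pi.

Lemma prime_pi_eq0 f : (prime_pi f == 0) = (f \in I).
Proof.
by rewrite -(rmorph0 prime_pi) -[in RHS](subr0 f); apply/esym/Quotient.idealrBE.
Qed.

End PrimeQuotient.

(** * Integer sequences tending to zero 2-adically along an ultrafilter *)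

Section TwoAdicIdeal.
Variables (U : set_system nat) (FU : UltraFilter U).

(* The unused argument lets the quotient structures recover the ultrafilter
   proof by unification. *)
Definition two_adic_null of UltraFilter U : pred (nat -> int) :=
  fun f => `[< forall n, U [set k | (2 ^+ n %| f k)%Z] >].

Lemma two_adic_null_ideal : idealr_closed (two_adic_null FU).
Proof.
split=> [||f g h /asboolP gU /asboolP hU].
- by apply/asboolP => n; apply: filterS filterT => k _ /=; rewrite dvdz0.
- by apply/negP => /asboolP /(_ 1%N) /filter_ex[k].
- apply/asboolP => n; apply: filterS2 (gU n) (hU n) => k /= a b.
  by rewrite rpredD // dvdz_mull.
Qed.

(** If neither factor is null, the ultrafilter gives a large set on which 2^m does not divide [f]
    and 2^n does not divide [g]; valuations add, so 2^(m+n) does not divide the product there. *)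
Lemma two_adic_null_prime : prime_idealr_closed (two_adic_null FU).
Proof.
move=> f g /asboolP fgU; apply/orP.
have [|nf] := pselect (f \in (two_adic_null FU)); [by left|right].
apply/asboolP => n; apply: contrapT => ng.
case: nf; apply/asboolP => m; apply: contrapT => nf.
have [//|nf'] := in_ultra_setVsetC [set k | (2 ^+ m %| f k)%Z] FU.
have [//|ng'] := in_ultra_setVsetC [set k | (2 ^+ n %| g k)%Z] FU.
have : U (~` [set k | (2 ^+ m %| f k)%Z] `&` ~` [set k | (2 ^+ n %| g k)%Z]
          `&` [set k | (2 ^+ (m + n) %| (f * g) k)%Z]).
  by apply: filterI => //; apply: filterI.
move=> /filter_ex[k [[/= nfk ngk] fgk]].
have f0 : f k != 0 by apply: contra_notN nfk => /eqP->; rewrite dvdz0.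
have g0 : g k != 0 by apply: contra_notN ngk => /eqP->; rewrite dvdz0.
move: nfk ngk fgk; rewrite !dvdzE !abszX abszM !pfactor_dvdn ?muln_gt0 ?absz_gt0 ?f0 ?g0 //.
by rewrite lognM ?absz_gt0 //; lia.
Qed.

HB.instance Definition _ := isIdealr.Build _ (two_adic_null FU) two_adic_null_ideal.
HB.instance Definition _ :=
  isPrimeIdealrClosed.Build _ (two_adic_null FU) two_adic_null_prime.

End TwoAdicIdeal.

(** The ultrafilter contains all cofinite sets, so [L] is a copy of the 2-adic integers and [lim] is
    the limit along the ultrafilter. Every integer sequence has such a limit, which spares any proof
    of convergence. *)
Theorem two_adic_limit : exists (L : idomainType) (lim : {rmorphism (nat -> int) -> L}),
  [/\ forall f, (forall n, (2 ^+ n %| f n)%Z) -> lim f = 0,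
      forall f, (forall n, ~~ (2 %| f n)%Z) -> lim f != 0
    & forall z : int, z%:~R = 0 :> L -> z = 0].
Proof.
have /ultraFilterLemma[U [FU cofinU]] : ProperFilter (\oo : set_system nat).
  exact: eventually_filter.
pose I : prime_idealr (nat -> int) := two_adic_null FU.
exists (prime_quot I), (prime_pi I : {rmorphism _ -> _}).
have lim0 f : (prime_pi I f == 0) = two_adic_null FU f by rewrite prime_pi_eq0.
have cofin n : U [set k | (n <= k)%N] by apply: cofinU; exists n.
split.
- move=> f fn; apply/eqP; rewrite lim0; apply/asboolP => n.
  apply: filterS (cofin n) => k /= nk; apply: dvdz_trans (fn k).
  by apply: dvdz_exp2l.
- move=> f fn; rewrite lim0; apply/negP => /asboolP/(_ 1%N)/filter_ex[k] /=.
  by rewrite expr1 (negPf (fn k)).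
- move=> z; rewrite -(rmorph_int (prime_pi I)) => /eqP; rewrite lim0 => /asboolP zU.
  apply/eqP/negPn/negP => z0.
  have /filter_ex[k /=] := zU `|z|%N.
  have -> : (z%:~R : nat -> int) k = z.
    have nat_at m : (m%:R : nat -> int) k = m%:R.
      by elim: m => // m IH; rewrite !mulrSr -[LHS]/((m%:R : nat -> int) k + 1) IH.
    case: (intP z) => [//|m|m]; first by rewrite -pmulrn nat_at natz.
    by rewrite mulrNz -pmulrn -[LHS]/(- (m.+1%:R : nat -> int) k) nat_at natz.
  rewrite dvdzE abszX => /dvdn_leq; rewrite absz_gt0 => /(_ z0).
  by rewrite leqNgt ltn_expl.
Qed.

(** * Finite sums and involutions *)

Section FiniteSums.
Variable I : choiceType.

Lemma fsum_fibers (k : zmodType) (J : choiceType) (A : set I) (B : set J) (g : I -> J)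
    (f : I -> k) : finite_set A -> finite_set B -> (forall i, A i -> B (g i)) ->
  \sum_(i \in A) f i = \sum_(j \in B) \sum_(i \in A `&` g @^-1` [set j]) f i.
Proof.
move=> fA fB gAB; rewrite fsbig_finite // fsbig_finite //.
have inner j : \sum_(i \in A `&` g @^-1` [set j]) f i =
    \sum_(i <- fset_set A | g i == j) f i.
  rewrite fsbig_finite; last exact: finite_setIl.
  rewrite -[RHS]big_filter; apply: perm_big; apply: uniq_perm.
  - exact: fset_uniq.
  - by rewrite filter_uniq // fset_uniq.
  move=> i; rewrite mem_filter !in_fset_set //; last exact: finite_setIl.
  apply/idP/andP => [/set_mem[Ai /= ->]|[/eqP gi /set_mem Ai]].
    by split; rewrite ?inE.
  exact/mem_set.
rewrite (eq_bigr _ (fun j _ => inner j)).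
rewrite (exchange_big_dep xpredT) //= big_seq [RHS]big_seq.
apply: eq_bigr => i; rewrite in_fset_set // inE => Ai.
rewrite big_mkcond (bigD1_seq (g i)) ?fset_uniq //=; last first.
  by rewrite in_fset_set // inE; apply: gAB.
by rewrite eqxx big1 ?addr0 // => j /negPf; rewrite eq_sym => ->.
Qed.

Lemma fsum_split (k : zmodType) (A P : set I) (f : I -> k) : finite_set A ->
  \sum_(i \in A) f i = \sum_(i \in A `&` P) f i + \sum_(i \in A `\` P) f i.
Proof.
move=> fA; rewrite -fsbigU0; first by rewrite setUIDK.
- exact: finite_setIl.
- exact: finite_setD.
- by move=> x [[_ Px] [_ nPx]].
Qed.

(** The list [r] holds one element of each orbit. It is returned explicitly because over a field
    being twice something carries no information; what matters is which terms are doubled. *)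
Lemma sum_free_involution (k : zmodType) (s : I -> I) (f : I -> k) (l : seq I) :
  uniq l -> (forall i, i \in l -> [/\ s i \in l, s (s i) = i, s i != i & f (s i) = f i]) ->
  exists r : seq I, {subset r <= l} /\ \sum_(i <- l) f i = (\sum_(i <- r) f i) *+ 2.
Proof.
have [n] := ubnP (size l); elim: n l => // n IH [|x l] /=.
  by move=> _ _ _; exists [::]; rewrite !big_nil mul0rn.
rewrite ltnS => sl /andP[xl ul] ls.
have [sxl ssx sx fx] := ls x (mem_head _ _).
have {}sxl : s x \in l by move: sxl; rewrite inE (negPf sx).
have ml y : (y \in rem (s x) l) = (y != s x) && (y \in l) by rewrite mem_rem_uniq.
have [||y|r [rl E]] := IH (rem (s x) l); rewrite ?rem_uniq //.
- by rewrite size_rem //; apply: leq_ltn_trans (leq_pred _) sl.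
- rewrite !ml => /andP[ysx yl].
  have [syl ssy sy fy] := ls y (mem_behead (s := x :: l) yl).
  split => //; move: syl; rewrite inE => /predU1P[syx|->].
    by move: ysx; rewrite -syx ssy eqxx.
  by rewrite andbT; apply: contraNneq xl => /(congr1 s); rewrite ssy ssx => <-.
exists (x :: r); split.
  by move=> y; rewrite !inE => /predU1P[->|/rl]; rewrite ?eqxx // ml =>
    /andP[_ ->]; rewrite orbT.
by rewrite !big_cons (big_rem _ sxl) /= E fx addrA mulrnDl mulr2n.
Qed.

Lemma fsum_free_involution (k : zmodType) (A : set I) (s : I -> I) (f : I -> k) :
  finite_set A ->
  (forall i, A i -> [/\ A (s i), s (s i) = i, s i <> i & f (s i) = f i]) ->
  exists r : seq I, (forall i, i \in r -> A i) /\
    \sum_(i \in A) f i = (\sum_(i <- r) f i) *+ 2.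
Proof.
move=> fA As; rewrite fsbig_finite //.
have [|i|r [rA ->]] := @sum_free_involution k s f (fset_set A); first exact: fset_uniq.
  rewrite in_fset_set // => /set_mem/As[Asi ssi /eqP si fi].
  by split => //; rewrite in_fset_set // inE.
by exists r; split => // i /rA; rewrite in_fset_set // inE.
Qed.

Lemma fsum_image_ord (k : zmodType) n (c : 'I_n -> I) (f : I -> k) : injective c ->
  \sum_(i \in range c) f i = \sum_(a < n) f (c a).
Proof.
move=> c_inj; rewrite fsbig_image; last by move=> a b _ _; apply: c_inj.
rewrite [RHS]fsbig_seq ?index_enum_uniq //; apply: eq_fsbigl.
by apply/seteqP; split => // a _; rewrite /= mem_index_enum.
Qed.

End FiniteSums.

Lemma dvdz_fsum (I : choiceType) (A : set I) (f : I -> int) (d : int) :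
  finite_set A -> (forall i, A i -> (d %| f i)%Z) -> (d %| \sum_(i \in A) f i)%Z.
Proof.
move=> fA h; rewrite fsbig_finite // big_seq; apply: rpred_sum => i.
by rewrite in_fset_set // inE; apply: h.
Qed.

Lemma dvdz_fsum_free_involution (I : choiceType) (A : set I) (s : I -> I)
    (f : I -> int) (d : int) : finite_set A ->
  (forall i, A i -> [/\ A (s i), s (s i) = i, s i <> i & f (s i) = f i]) ->
  (forall i, A i -> (d %| f i)%Z) -> (2 * d %| \sum_(i \in A) f i)%Z.
Proof.
move=> fA As df; have [r [rA ->]] := fsum_free_involution fA As.
rewrite -[_ *+ 2]mulr_natl dvdz_mul //.
by rewrite big_seq; apply: rpred_sum => i /rA/df.
Qed.

Lemma fsumB (I : choiceType) (k : zmodType) (A : set I) (f g : I -> k) : finite_set A ->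
  \sum_(i \in A) (f i - g i) = \sum_(i \in A) f i - \sum_(i \in A) g i.
Proof. by move=> fA; rewrite !fsbig_finite // sumrB. Qed.

(** * Embeddings and codes of generated structures *)

Lemma dependent_choice (A : Type) (B : A -> Type) (R : forall a, B a -> Prop) :
  (forall a, exists b, R a b) -> exists f, forall a, R a (f a).
Proof. by move=> h; exists (fun a => projT1 (cid (h a))) => a; case: cid. Qed.

Section Embeddings.
Variable S : signature.
Implicit Types X Y Z W : struct S.

Lemma emb_inj X Y (f : {ffun X -> Y}) : embedding f -> injective f.
Proof. by case. Qed.

Lemma compfE X Y Z (g : {ffun Y -> Z}) (f : {ffun X -> Y}) x : compf g f x = g (f x).
Proof. by rewrite ffunE. Qed.

Lemma map_tuple_comp (A B C : Type) n (g : B -> C) (f : A -> B) (t : n.-tuple A) :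
  map_tuple (g \o f) t = map_tuple g (map_tuple f t).
Proof. by apply: val_inj; rewrite /= map_comp. Qed.

Lemma map_tuple_ext (A B : Type) n (g f : A -> B) (t : n.-tuple A) :
  f =1 g -> map_tuple f t = map_tuple g t.
Proof. by move=> fg; apply: val_inj; rewrite /= (eq_map fg). Qed.

Lemma comp_emb X Y Z (g : {ffun Y -> Z}) (f : {ffun X -> Y}) :
  embedding g -> embedding f -> embedding (compf g f).
Proof.
move=> [gi gr] [fi fr]; split=> [x y|r t].
  by rewrite !compfE => /gi/fi.
by rewrite (map_tuple_ext _ (compfE g f)) map_tuple_comp gr fr.
Qed.

Definition idf X : {ffun X -> X} := [ffun x => x].

Lemma idf_iso X : isomorphism (idf X).
Proof.
split; last by exists (idf X) => x; rewrite !ffunE.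
split=> [x y|r t]; first by rewrite !ffunE.
by congr interp; apply: val_inj; rewrite /= -[RHS]map_id; apply: eq_map => x; rewrite ffunE.
Qed.

Lemma incl_emb X (A : {set X}) : embedding (incl A).
Proof.
split=> [x y|r t]; first by rewrite !ffunE => /val_inj.
by rewrite /=; congr interp; apply: map_tuple_ext => x; rewrite ffunE.
Qed.

Lemma inclE X (A : {set X}) (u : induced A) : incl A u = val u.
Proof. by rewrite ffunE. Qed.

Lemma incl_subE X (A B : {set X}) (sAB : A \subset B) u : val (incl_sub sAB u) = val u.
Proof. by rewrite ffunE. Qed.

Lemma emb_factor X Y Z (g : {ffun Y -> Z}) (f : {ffun X -> Y}) :
  embedding g -> embedding (compf g f) -> embedding f.
Proof.
move=> [gi gr] [fi fr]; split=> [x y xy|r t].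
  by apply: fi; rewrite !compfE xy.
by rewrite -fr -gr -map_tuple_comp; congr interp; apply: map_tuple_ext => x /=; rewrite compfE.
Qed.

Lemma incl_sub_emb X (A B : {set X}) (sAB : A \subset B) : embedding (incl_sub sAB).
Proof.
apply: (emb_factor (incl_emb B)).
suff -> : compf (incl B) (incl_sub sAB) = incl A by apply: incl_emb.
by apply/ffunP => u; rewrite compfE !inclE incl_subE.
Qed.

Lemma iso_emb X Y (f : {ffun X -> Y}) : isomorphism f -> embedding f.
Proof. by case. Qed.

Lemma surj_iso X Y (f : {ffun X -> Y}) :
  embedding f -> (forall y, exists x, f x = y) -> isomorphism f.
Proof.
move=> ef fs; split => //.
have /choice[g gK] := fs.
by exists g => // x; apply: (emb_inj ef); rewrite gK.
Qed.

Lemma iso_inv X Y (f : {ffun X -> Y}) : isomorphism f ->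
  exists g : {ffun Y -> X}, [/\ isomorphism g, cancel f g & cancel g f].
Proof.
move=> [ef [g fK gK]]; exists (finfun g).
have K1 : cancel f (finfun g) by move=> x; rewrite ffunE.
have K2 : cancel (finfun g) f by move=> x; rewrite ffunE.
split => //; split; last by exists f.
apply: (emb_factor ef).
suff -> : compf f (finfun g) = idf Y by apply: iso_emb; apply: idf_iso.
by apply/ffunP => y; rewrite compfE K2 ffunE.
Qed.

Lemma corestrict X W (f : {ffun X -> W}) (A : {set W}) : embedding f ->
  (forall x, f x \in A) ->
  exists g : {ffun X -> induced A}, embedding g /\ forall x, val (g x) = f x.
Proof.
move=> ef fA; pose g : {ffun X -> induced A} :=
  [ffun x => exist (fun x => x \in A) (f x) (fA x)].
have gE x : val (g x) = f x by rewrite ffunE.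
exists g; split => //; apply: (emb_factor (incl_emb A)).
suff -> : compf (incl A) g = f by [].
by apply/ffunP => x; rewrite compfE inclE gE.
Qed.

End Embeddings.

(* A map [t] from an index type onto a structure is determined up to isomorphism
   by the kernel of [t] and the pulled-back relations. *)
Section Codes.
Variable S : signature.
Implicit Types X Y Z W : struct S.

Definition code_of (T : Type) : Type :=
  ((T -> T -> bool) * (forall r : S, (arity r).-tuple T -> bool))%type.

HB.instance Definition _ T := gen_eqMixin (code_of T).
HB.instance Definition _ T := gen_choiceMixin (code_of T).

Definition same T (w : code_of T) : T -> T -> bool := w.1.

Definition code T W (t : T -> W) : code_of T :=
  (fun a b => t a == t b, fun r s => interp (map_tuple t s)).

Definition pull T' T (u : T' -> T) (w : code_of T) : code_of T' :=
  (fun a b => w.1 (u a) (u b), fun r s => w.2 r (map_tuple u s)).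

Definition onto T T' (t : T -> T') : Prop := forall y, exists a, t a = y.

Lemma code_ext T W (t t' : T -> W) : t =1 t' -> code t = code t'.
Proof. by move=> /funext->. Qed.

Lemma pull_code T' T (u : T' -> T) W (t : T -> W) : pull u (code t) = code (t \o u).
Proof.
congr pair; apply/functional_extensionality_dep => r; apply/funext => s /=.
by rewrite map_tuple_comp.
Qed.

Lemma pull_pull T'' T' T (u : T' -> T) (v : T'' -> T') (w : code_of T) :
  pull v (pull u w) = pull (u \o v) w.
Proof.
congr pair; apply/functional_extensionality_dep => r; apply/funext => s /=.
by rewrite map_tuple_comp.
Qed.

Lemma pull_id T (w : code_of T) : pull id w = w.
Proof.
case: w => e R; congr pair; apply/functional_extensionality_dep => r; apply/funext => s /=.
by congr R; apply: val_inj; rewrite /= map_id.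
Qed.

Lemma code_emb T W W' (e : {ffun W -> W'}) (t : T -> W) : embedding e ->
  code (e \o t) = code t.
Proof.
move=> [ei er]; congr pair.
  by apply/funext => a; apply/funext => b /=; rewrite (inj_eq ei).
by apply/functional_extensionality_dep => r; apply/funext => s; rewrite map_tuple_comp er.
Qed.

Lemma code_sameP T W (t : T -> W) a b : same (code t) a b = (t a == t b).
Proof. by []. Qed.

Lemma map_tuple_onto T (W : Type) (t : T -> W) n (s : n.-tuple W) : onto t ->
  exists s', map_tuple t s' = s.
Proof.
move=> ts; have /choice[g gK] := ts.
exists (map_tuple g s); rewrite -map_tuple_comp.
by apply: val_inj; rewrite /= -[RHS]map_id; apply: eq_map => x /=.
Qed.

(** Equal kernels make the map sending [t a] to [s a] well defined and injective; equal relations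
    make it an embedding. *)
Lemma code_lift T W W' (t : T -> W) (s : T -> W') : onto t -> code t = code s ->
  exists h : {ffun W -> W'}, embedding h /\ forall a, h (t a) = s a.
Proof.
move=> ts cE; have /choice[g gK] := ts.
have kE a b : (t a == t b) = (s a == s b).
  by rewrite -[LHS]/(same (code t) a b) cE.
pose h : {ffun W -> W'} := [ffun w => s (g w)].
have hE a : h (t a) = s a by rewrite ffunE; apply/eqP; rewrite -kE gK.
exists h; split => //; split.
  move=> x y; have [[a <-] [b <-]] := (ts x, ts y).
  by rewrite !hE => /eqP; rewrite -kE => /eqP.
move=> r z; have [z' <-] := map_tuple_onto z ts.
rewrite -map_tuple_comp (map_tuple_ext (f := h \o t) (g := s)) //.
by rewrite -[LHS]/((code s).2 r z') -cE.
Qed.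

Lemma code_lift_iso T W W' (t : T -> W) (s : T -> W') : onto t -> onto s ->
  code t = code s -> exists h : {ffun W -> W'}, isomorphism h /\ forall a, h (t a) = s a.
Proof.
move=> ts ss /(code_lift ts)[h [eh hE]]; exists h; split => //.
by apply: surj_iso => // y; have [a <-] := ss y; exists (t a).
Qed.

End Codes.

(** * Amalgamations as finite sets of codes *)

Section GluedCodes.
Variables (S : signature) (F : struct S -> Prop).
Hypothesis F_fraisse : fraisse F.
Implicit Types X Y Z W : struct S.

Lemma hereditary X Y (f : {ffun Y -> X}) : F X -> embedding f -> F Y.
Proof. by case: F_fraisse => _ h _; apply: h. Qed.

Lemma F_induced X (A : {set X}) : F X -> F (induced A).
Proof. by move=> FX; apply: hereditary FX (incl_emb A). Qed.

Definition class_code T (w : code_of S T) : Prop :=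
  exists W (t : T -> W), [/\ F W, onto t & w = code t].

Lemma class_codeP (T : finType) W (t : T -> W) : F W -> class_code (code t).
Proof.
move=> FW; pose A : {set W} := [set t a | a : T].
have tA a : t a \in A by apply/imsetP; exists a.
exists (induced A), (fun a => exist _ (t a) (tA a)); split.
- exact: F_induced.
- move=> [y yA]; have /imsetP[a _ ya] := yA; exists a; apply: val_inj => /=.
  by rewrite ya.
- rewrite -(code_emb _ (incl_emb A)); apply: code_ext => a /=.
  by rewrite inclE.
Qed.

Lemma class_code_pull (T T' : finType) (u : T' -> T) (w : code_of S T) :
  class_code w -> class_code (pull u w).
Proof. by move=> [W [t [FW _ ->]]]; rewrite pull_code; apply: class_codeP. Qed.

(** The signature may be infinite, so finiteness comes from the class: a structure covered by [T]
    has at most [#|T|] elements, there are finitely many such structures up to isomorphism, and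
    finitely many maps from [T] to each. *)
Lemma finite_class_code (T : finType) : finite_set (@class_code T).
Proof.
case: F_fraisse => fin _ _.
have /choice[N hN] : forall n, exists N, exists s : 'I_N -> struct S,
    forall X, F X /\ #|X| = n -> exists a, isomorphic X (s a).
  by move=> n; have [N [s h]] := fin n; exists N, s.
have /dependent_choice[s hs] := hN.
apply: (@sub_finite_set _ _ (\bigcup_(n in `I_#|T|.+1) \bigcup_(a in [set: 'I_(N n)])
   range (fun t : {ffun T -> s n a} => code t))).
  move=> w [W [t [FW ts ->]]].
  have sW : (#|W| <= #|T|)%N.
    have /choice[g gK] := ts; apply: (leq_card g) => x y xy.
    by rewrite -(gK x) -(gK y) xy.
  have [a [f fi]] := hs _ _ (conj FW erefl).
  exists #|W|; first by rewrite /= ltnS.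
  exists a => //; exists [ffun x => f (t x)] => //.
  rewrite -(code_emb t (iso_emb fi)); apply: code_ext => x /=; by rewrite ffunE.
apply: bigcup_finite; first exact: finite_II.
move=> n _; apply: bigcup_finite; first exact: finite_finset.
by move=> a _; apply: finite_image; apply: finite_finset.
Qed.

(* [T] need only map onto the pushout of [p] and [q]; the identification of
   [k1 \o p] with [k2 \o q] is imposed on the codes in [glued]. *)
Definition gluing (T0 T1 T2 T : finType) (p : T0 -> T1) (q : T0 -> T2)
    (k1 : T1 -> T) (k2 : T2 -> T) : Prop :=
  (forall c, (exists a, k1 a = c) \/ (exists b, k2 b = c)) /\
  forall (Z : finType) (f1 : T1 -> Z) (f2 : T2 -> Z),
    (forall a, f1 (p a) = f2 (q a)) ->
    exists f : T -> Z, (forall a, f (k1 a) = f1 a) /\ (forall b, f (k2 b) = f2 b).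

(** When [y] and [x] code structures with a common part indexed by [T0], these are the codes of
    their amalgamations over that part, one for each isomorphism class. *)
Definition glued (T0 T1 T2 T : finType) (p : T0 -> T1) (q : T0 -> T2)
    (k1 : T1 -> T) (k2 : T2 -> T) (y : code_of S T1) (x : code_of S T2) :
    set (code_of S T) :=
  [set w | [/\ class_code w, pull k1 w = y, pull k2 w = x
             & forall a, same w (k1 (p a)) (k2 (q a))]].

Lemma finite_glued (T0 T1 T2 T : finType) (p : T0 -> T1) (q : T0 -> T2)
    (k1 : T1 -> T) (k2 : T2 -> T) y x : finite_set (glued p q k1 k2 y x).
Proof. by apply: sub_finite_set (finite_class_code T) => w []. Qed.

Lemma gluing_sum (T0 T1 T2 : finType) (p : T0 -> T1) (q : T0 -> T2) :
  gluing p q (inl : T1 -> T1 + T2)%type inr.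
Proof.
split; first by case=> a; [left|right]; exists a.
move=> Z f1 f2 _; exists (fun c => match c with inl a => f1 a | inr b => f2 b end).
by [].
Qed.

Section Realization.
Variables (T0 T1 T2 T : finType) (p : T0 -> T1) (q : T0 -> T2).
Variables (k1 : T1 -> T) (k2 : T2 -> T) (X Y X' : struct S).
Variables (i : {ffun X -> Y}) (j : {ffun X -> X'}).
Variables (t0 : T0 -> X) (t1 : T1 -> Y) (t2 : T2 -> X').
Hypotheses (glue : gluing p q k1 k2).
Hypotheses (t0_onto : onto t0) (t1_onto : onto t1) (t2_onto : onto t2).
Hypotheses (it : forall a, i (t0 a) = t1 (p a)) (jt : forall a, j (t0 a) = t2 (q a)).

Definition glue_map (c : cocone Y X') (g : T -> c) : Prop :=
  [/\ onto g, forall a, g (k1 a) = inY c (t1 a) & forall b, g (k2 b) = inX' c (t2 b)].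

Lemma glue_map_exists c : amalgamation F i j c -> exists g, glue_map (c := c) g.
Proof.
move=> [Fc eX eY comm cover].
have [_ /(_ c (inY c \o t1) (inX' c \o t2))[a|g [g1 g2]]] := glue.
  by rewrite /= -it -jt -!compfE comm.
exists g; split => // z; case: (cover z) => /codomP[x ->].
  by have [b <-] := t2_onto x; exists (k2 b).
by have [a <-] := t1_onto x; exists (k1 a).
Qed.

Lemma glue_map_ext (c : cocone Y X') g g' : glue_map (c := c) g -> glue_map (c := c) g' -> g =1 g'.
Proof.
move=> [_ g1 g2] [_ g1' g2'] z; case: glue => /(_ z)[[a <-]|[b <-]] _.
  by rewrite g1 g1'.
by rewrite g2 g2'.
Qed.

Lemma glue_map_code c g : amalgamation F i j c -> glue_map (c := c) g ->
  glued p q k1 k2 (code t1) (code t2) (code g).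
Proof.
move=> [Fc eX eY comm cover] [g_onto g1 g2]; split.
- exact: class_codeP.
- by rewrite pull_code -(code_emb t1 eY); apply: code_ext => a /=.
- by rewrite pull_code -(code_emb t2 eX); apply: code_ext => a /=.
- by move=> a; rewrite code_sameP g1 g2 -it -jt -!compfE comm.
Qed.

Lemma glue_map_iso c d g h : amalgamation F i j c -> amalgamation F i j d ->
  glue_map (c := c) g -> glue_map (c := d) h -> code g = code h -> cocone_iso c d.
Proof.
move=> ac ad [g_onto g1 g2] [h_onto h1 h2] /(code_lift_iso g_onto h_onto)[f [fi fE]].
exists f; split => //; apply/ffunP => x; rewrite compfE.
  by have [b <-] := t2_onto x; rewrite -g2 fE h2.
by have [a <-] := t1_onto x; rewrite -g1 fE h1.
Qed.

Lemma iso_glue_map c d g h : cocone_iso c d -> glue_map (c := c) g ->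
  glue_map (c := d) h -> code g = code h.
Proof.
move=> [f [fi fX fY]] gm hm; rewrite -(code_emb g (iso_emb fi)); apply: code_ext.
apply: glue_map_ext hm; case: gm => g_onto g1 g2; split => [z|a|b] /=.
- have [f' [_ _ fK]] := iso_inv fi; have [x xE] := g_onto (f' z).
  by exists x; rewrite xE fK.
- by rewrite g1 -fY compfE.
- by rewrite g2 -fX compfE.
Qed.

Lemma glued_cocone w : glued p q k1 k2 (code t1) (code t2) w ->
  exists c g, [/\ amalgamation F i j c, glue_map (c := c) g & code g = w].
Proof.
move=> [[W [t [FW t_onto ->]]]]; rewrite !pull_code => /esym c1 /esym c2 st.
have [f1 [e1 f1E]] := code_lift t1_onto c1.
have [f2 [e2 f2E]] := code_lift t2_onto c2.
exists (Cocone f2 f1), t; split => //; split => //=.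
- apply/ffunP => x; have [a <-] := t0_onto x.
  rewrite !compfE it jt f1E f2E /=; apply/eqP; rewrite eq_sym; exact: st.
- move=> z; have [x <-] := t_onto z; case: glue => /(_ x)[[a <-]|[b <-]] _.
    by right; apply/codomP; exists (t1 a); rewrite f1E.
  by left; apply/codomP; exists (t2 b); rewrite f2E.
Qed.

(** An isomorphism of cocones fixes the images of all generators, so it exists exactly when the
    codes of the apexes agree. This is what turns a sum over representatives into a sum over a
    set. *)
Lemma amalgamations_glued n (c : 'I_n -> cocone Y X') : amalgamations F i j c ->
  exists g : forall a, T -> c a, [/\ forall a, glue_map (c := c a) (g a),
    injective (fun a => code (g a))
    & glued p q k1 k2 (code t1) (code t2) = range (fun a => code (g a))].
Proof.
move=> [ac c_inj c_cover].
have /dependent_choice[g gP] : forall a, exists g, glue_map (c := c a) g.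
  by move=> a; apply: glue_map_exists.
exists g; split => //.
  by move=> a b ab; apply: c_inj; apply: glue_map_iso ab.
apply/seteqP; split => w; last by move=> [a _ <-]; apply: glue_map_code.
move=> /glued_cocone[d [h [ad hm <-]]]; have [a da] := c_cover _ ad.
by exists a => //; apply/esym; apply: iso_glue_map hm (gP a).
Qed.

End Realization.

(** The finite set of glued codes on the disjoint sum, with each structure indexed by itself, is
    enumerated and each code is realized by a cocone. *)
Lemma amalgamations_exist X Y X' (i : {ffun X -> Y}) (j : {ffun X -> X'}) :
  exists n (c : 'I_n -> cocone Y X'), amalgamations F i j c.
Proof.
have glue := gluing_sum i j.
have onto_id (Z : struct S) : onto (id : Z -> Z) by move=> z; exists z.
pose G := glued i j (inl : Y -> Y + X')%type inr (code id) (code id).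
have fG : finite_set G by apply: finite_glued.
pose s := enum_fset (fset_set G).
have sG w : w \in s -> G w by rewrite in_fset_set // inE.
have /dependent_choice[c cP] : forall a : 'I_(size s), exists c,
    exists g, [/\ amalgamation F i j c, glue_map inl inr id id (c := c) g
                & code g = tnth (in_tuple s) a].
  move=> a; have /sG := mem_tnth a (in_tuple s).
  by move=> /(@glued_cocone _ _ _ _ _ _ _ _ _ _ _ i j id id id); apply.
exists (size s), c; split.
- by move=> a; have [g []] := cP a.
- move=> a b ab; have [g [_ gm gE]] := cP a; have [h [_ hm hE]] := cP b.
  have us : uniq (in_tuple s) by apply: fset_uniq.
  have /tuple_uniqP s_inj := us; apply: s_inj; rewrite -gE -hE.
  exact: (iso_glue_map glue ab gm hm).
- move=> d ad.
  have [h hm] := glue_map_exists glue (onto_id _) (onto_id _)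
    (fun=> erefl) (fun=> erefl) ad.
  have : code h \in in_tuple s.
    rewrite in_fset_set // inE.
    exact: (@glue_map_code _ _ _ _ i j inl inr _ _ _ i j id id id
      (fun=> erefl) (fun=> erefl) _ _ ad hm).
  move=> /tnthP[a ha]; exists a; have [g [ag gm gE]] := cP a.
  by apply: (glue_map_iso (onto_id _) (onto_id _) ad ag hm gm); rewrite gE.
Qed.

End GluedCodes.

(** * Values on codes and off-diagonal sums *)

Section ExtensionValues.
Variables (S : signature) (F : struct S -> Prop).
Hypothesis F_fraisse : fraisse F.
Implicit Types X Y Z W : struct S.

Section Value.
Variables (k : zmodType) (mu : forall X Y, {ffun X -> Y} -> k).

(** A measure modulo [N] has this property only up to multiples of [N], while [extval] needs exact
    values independent of the realization; so it is carried along separately. *)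
Definition iso_invariant : Prop :=
  forall X Y X' Y' (i : {ffun X -> Y}) (i' : {ffun X' -> Y'})
      (g : {ffun X -> X'}) (h : {ffun Y -> Y'}),
    F Y -> F Y' -> embedding i -> embedding i' -> isomorphism g -> isomorphism h ->
    (forall x, h (i x) = i' (g x)) -> mu i = mu i'.

(* [mu] of the inclusion into the structure coded by [w] of the part indexed
   by [u]; the junk value 0 only occurs outside the class. *)
Definition extval (T' T : finType) (u : T' -> T) (w : code_of S T) : k :=
  xget 0 [set x | exists W (t : T -> W), [/\ F W, onto t, w = code t
                  & x = mu (incl [set t (u a) | a : T'])]].

Hypothesis mu_inv : iso_invariant.

Lemma extvalE (T' T : finType) (u : T' -> T) X W (t : T -> W) (t0 : T' -> X)
    (e : {ffun X -> W}) : F W -> onto t -> onto t0 -> embedding e ->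
  (forall a, e (t0 a) = t (u a)) -> extval u (code t) = mu e.
Proof.
move=> FW t_onto t0_onto ee et.
pose V := [set x | exists W' (t' : T -> W'), [/\ F W', onto t', code t = code t'
                  & x = mu (incl [set t' (u a) | a : T'])]].
have : V (xget 0 V) by apply: xgetPex; exists (mu (incl [set t (u a) | a : T'])), W, t.
rewrite -[xget 0 V]/(extval u (code t)) => -[W' [t' [FW' t'_onto cE ->]]].
have [h [ih hE]] := code_lift_iso t_onto t'_onto cE.
have [||g [eg gE]] := corestrict (f := compf h e) (A := [set t' (u a) | a : T']).
- by apply: comp_emb => //; apply: iso_emb.
- move=> x; have [a <-] := t0_onto x; rewrite compfE et hE.
  by apply/imsetP; exists a.
apply/esym; apply: (mu_inv (g := g) (h := h)) => //; first exact: incl_emb.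
  apply: surj_iso => // y; have /imsetP[a _ ya] := valP y.
  by exists (t0 a); apply: val_inj; rewrite gE compfE et hE.
by move=> x; rewrite inclE gE compfE.
Qed.

Lemma onto_codom (T' : finType) W (s : T' -> W) :
  exists t0 : T' -> induced [set s a | a : T'], onto t0 /\ forall a, val (t0 a) = s a.
Proof.
have sA a : s a \in [set s a | a : T'] by apply/imsetP; exists a.
exists (fun a => exist _ (s a) (sA a)); split => // y.
have /imsetP[a _ ya] := valP y; exists a.
by apply: val_inj => /=.
Qed.

Lemma extval_incl (T' T : finType) (u : T' -> T) W (t : T -> W) : F W -> onto t ->
  extval u (code t) = mu (incl [set t (u a) | a : T']).
Proof.
move=> FW t_onto; have [t0 [t0_onto t0E]] := onto_codom (fun a => t (u a)).
by apply: extvalE t0_onto _ _ => // [|a]; [apply: incl_emb|rewrite inclE t0E].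
Qed.

Lemma extval_pull (T' T T1 : finType) (s : T1 -> T) (u : T' -> T1) (w : code_of S T) :
  onto s -> class_code F w -> extval u (pull s w) = extval (s \o u) w.
Proof.
move=> s_onto [W [t [FW t_onto ->]]]; rewrite pull_code !extval_incl // => y.
by have [x <-] := t_onto y; have [z <-] := s_onto x; exists z.
Qed.

Lemma extval_same (T' T : finType) (u u' : T' -> T) (w : code_of S T) :
  class_code F w -> (forall a, same w (u a) (u' a)) -> extval u w = extval u' w.
Proof.
move=> [W [t [FW t_onto ->]]] uu'; rewrite !extval_incl //.
by congr (mu (incl _)); apply: eq_imset => a; apply/eqP; apply: uu'.
Qed.

Lemma sum_glued (T0 T1 T2 T : finType) (p : T0 -> T1) (q : T0 -> T2)
    (k1 : T1 -> T) (k2 : T2 -> T) X Y X' (i : {ffun X -> Y}) (j : {ffun X -> X'})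
    (t0 : T0 -> X) (t1 : T1 -> Y) (t2 : T2 -> X') n (c : 'I_n -> cocone Y X') :
  gluing p q k1 k2 -> onto t0 -> onto t1 -> onto t2 ->
  (forall a, i (t0 a) = t1 (p a)) -> (forall a, j (t0 a) = t2 (q a)) ->
  amalgamations F i j c ->
  exists g : forall a, T -> c a, (forall a, glue_map k1 k2 t1 t2 (g a)) /\
    forall f : code_of S T -> k,
      \sum_(w \in glued F p q k1 k2 (code t1) (code t2)) f w =
      \sum_(a < n) f (code (g a)).
Proof.
move=> gl o0 o1 o2 it jt ac.
have [g [gm g_inj gE]] := amalgamations_glued F_fraisse gl o0 o1 o2 it jt ac.
by exists g; split => // f; rewrite gE fsum_image_ord.
Qed.

Definition offdiagonal (T1 T : finType) (k1 k2 : T1 -> T) : set (code_of S T) :=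
  [set w | ~ forall a, same w (k1 a) (k2 a)].

(** This is the sum D(i); off the diagonal means that the two copies of [Y] are different maps into
    the amalgamation. *)
Definition offdiag X Y (i : {ffun X -> Y}) : k :=
  \sum_(w \in glued F i i (inl : Y -> Y + Y)%type inr (code id) (code id)
              `&` offdiagonal inl inr) extval (inl \o i) w.

Lemma sum_offdiagonal (T0 T1 T : finType) (p : T0 -> T1) (k1 k2 : T1 -> T) X Y
    (i : {ffun X -> Y}) (t0 : T0 -> X) (t1 : T1 -> Y) n (c : 'I_n -> cocone Y Y) :
  embedding i -> gluing p p k1 k2 -> onto t0 -> onto t1 -> (forall a, i (t0 a) = t1 (p a)) ->
  amalgamations F i i c ->
  \sum_(w \in glued F p p k1 k2 (code t1) (code t1) `&` offdiagonal k1 k2)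
     extval (k1 \o p) w =
  \sum_(a < n) if inY (c a) == inX' (c a) then 0 else mu (compf (inY (c a)) i).
Proof.
move=> ei gl o0 o1 it ac.
have [g [gm gE]] := sum_glued gl o0 o1 o1 it it ac.
rewrite fsbig_mkcondr gE; apply: eq_bigr => a _; have [g_onto g1 g2] := gm a.
have [Fc eX eY _ _] := let: And3 ac _ _ := ac in ac a.
rewrite -[RHS]if_neg; congr (if _ then _ else _).
  apply/idP/idP => [wo|/eqP h].
    have h := set_mem wo; apply/eqP => E; apply: h => x; by rewrite code_sameP g1 g2 E.
  apply/mem_set => h'; apply: h; apply/ffunP => y; have [x <-] := o1 y.
  by rewrite -g1 -g2; apply/eqP; apply: h'.
apply: extvalE o0 _ _ => //; first exact: comp_emb.
by move=> x; rewrite compfE it g1.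
Qed.

(** Both sides equal the same sum over a list of amalgamations of [Y] with itself. The freedom in
    the indexing serves when [i] appears inside a code on a larger index set. *)
Lemma offdiag_glued (T0 T1 T : finType) (p : T0 -> T1) (k1 k2 : T1 -> T) X Y
    (i : {ffun X -> Y}) (t0 : T0 -> X) (t1 : T1 -> Y) :
  embedding i -> gluing p p k1 k2 -> onto t0 -> onto t1 -> (forall a, i (t0 a) = t1 (p a)) ->
  offdiag i = \sum_(w \in glued F p p k1 k2 (code t1) (code t1) `&` offdiagonal k1 k2)
     extval (k1 \o p) w.
Proof.
move=> ei gl o0 o1 it; have [n [c ac]] := amalgamations_exist F_fraisse i i.
rewrite (sum_offdiagonal ei gl o0 o1 it ac) /offdiag.
have onto_id W : onto (id : W -> W) by move=> z; exists z.
exact: (sum_offdiagonal ei (gluing_sum i i) (onto_id _) (onto_id _) (fun=> erefl) ac).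
Qed.

End Value.

Lemma iso_onto X Y (f : {ffun X -> Y}) : isomorphism f -> onto f.
Proof. by move=> /iso_inv[g [_ _ gK]] y; exists (g y). Qed.

Lemma offdiag_inv (k : zmodType) (mu : forall X Y, {ffun X -> Y} -> k) :
  iso_invariant mu -> iso_invariant (offdiag mu).
Proof.
move=> mu_inv X Y X' Y' i i' g h FY FY' ei ei' ig ih E.
rewrite (offdiag_glued (i := i') (p := i) mu_inv ei' (gluing_sum i i)
  (iso_onto ig) (iso_onto ih)).
  by have -> : code h = code id := code_emb id (iso_emb ih).
by move=> x; rewrite -E.
Qed.

End ExtensionValues.

Lemma dvdz_sum_symmetric n (f : 'I_n -> 'I_n -> int) (N : int) :
  (forall a b, f a b = f b a) -> (forall a b, a != b -> (N %| f a b)%Z) ->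
  (2 * N %| \sum_a \sum_(b | b != a) f a b)%Z.
Proof.
move=> fC Nf.
have -> : \sum_a \sum_(b | b != a) f a b = (\sum_(a < n) \sum_(b < n | (b < a)%N) f a b) *+ 2.
  transitivity (\sum_(a < n) (\sum_(b < n | (b < a)%N) f a b + \sum_(b < n | (a < b)%N) f a b)).
    apply: eq_bigr => a _; rewrite (bigID (fun b : 'I_n => (b < a)%N)) /=.
    by congr (_ + _); apply: eq_bigl => b; rewrite -val_eqE /=; case: ltngtP.
  rewrite big_split /= mulr2n; congr (_ + _).
  rewrite (exchange_big_dep xpredT) //=; apply: eq_bigr => a _; exact: eq_bigr.
rewrite -[_ *+ 2]mulr_natl dvdz_mul //.
apply: rpred_sum => a _; apply: rpred_sum => b ba; apply: Nf.
by rewrite -val_eqE gtn_eqF.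
Qed.

(** * The swap of two copies and its freeness *)

Section ModularMeasures.
Variables (S : signature) (F : struct S -> Prop).
Hypothesis F_fraisse : fraisse F.
Implicit Types X Y Z W : struct S.

Definition swap (T : Type) (c : T + T) : T + T :=
  match c with inl a => inr a | inr a => inl a end.

Lemma swapK T : involutive (@swap T).
Proof. by case. Qed.

Lemma pull_swapK (T : Type) (w : code_of S (T + T)) : pull (@swap T) (pull (@swap T) w) = w.
Proof.
by rewrite pull_pull -[RHS]pull_id; congr pull; apply/funext; case.
Qed.

Lemma onto_id (T : Type) : onto (id : T -> T).
Proof. by move=> x; exists x. Qed.

Lemma invol_onto T (s : T -> T) : involutive s -> onto s.
Proof. by move=> sK x; exists (s x). Qed.

Section OddAutomorphisms.
Hypothesis odd_aut : forall X, F X -> odd #|automorphisms X|.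

Lemma automorphism_group W : group_set (automorphisms W).
Proof.
apply/group_setP; split=> [|s1 s2].
  rewrite inE; suff <- : idf W = [ffun x => (1%g : {perm W}) x].
    by apply/asboolP; apply: iso_emb; apply: idf_iso.
  by apply/ffunP => x; rewrite !ffunE perm1.
rewrite !inE => e1 e2; have := comp_emb e2 e1.
suff -> : compf [ffun x => s2 x] [ffun x => s1 x] = [ffun x => (s1 * s2)%g x] by [].
by apply/ffunP => x; rewrite !ffunE permM.
Qed.

(** The order of such an automorphism divides 2 and, by Lagrange, an odd number. *)
Lemma involutive_automorphism W (h : {ffun W -> W}) : F W -> embedding h ->
  (forall x, h (h x) = x) -> forall x, h x = x.
Proof.
move=> FW eh hK x; pose s := perm (emb_inj eh).
have s2 : (s ^+ 2 = 1)%g by apply/permP => y; rewrite permM perm1 !permE.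
have sA : s \in Group (automorphism_group W).
  rewrite inE; suff -> : [ffun x => s x] = h by apply/asboolP.
  by apply/ffunP => y; rewrite ffunE permE.
have s1 : #[s]%g = 1%N.
  have := order_dvdG sA; have : (#[s]%g %| 2)%N by rewrite order_dvdn s2.
  rewrite dvdn_divisors // => /=; rewrite !inE => /orP[/eqP//|/eqP->].
  by rewrite dvdn2 odd_aut.
have := expg_order s; rewrite s1 expg1 => /permP/(_ x).
by rewrite perm1 permE.
Qed.

(** A code fixed by an involution of its index set yields an involutive automorphism of the coded
    structure, which must be trivial. Hence the swap has no fixed point off the diagonal. *)
Lemma pull_invol_fixed (T : finType) (s : T -> T) (w : code_of S T) : involutive s ->
  class_code F w -> pull s w = w -> forall a, same w (s a) a.
Proof.
move=> sK [W [t [FW t_onto ->]]]; rewrite pull_code => sw a.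
have [h [eh hE]] := code_lift t_onto (esym sw).
rewrite code_sameP -[t (s a)]hE; apply/eqP.
apply: (involutive_automorphism FW eh) => x; have [b <-] := t_onto x.
by rewrite !hE /= sK.
Qed.

End OddAutomorphisms.
End ModularMeasures.

(** * Measures modulo N in terms of codes *)

Section ModularMeasures.
Variables (S : signature) (F : struct S -> Prop).
Hypothesis F_fraisse : fraisse F.
Implicit Types X Y Z W : struct S.

Lemma same_sym T (w : code_of S T) a b : class_code F w -> same w a b -> same w b a.
Proof. by move=> [W [t [_ _ ->]]]; rewrite !code_sameP eq_sym. Qed.

Lemma same_trans T (w : code_of S T) b a c : class_code F w ->
  same w a b -> same w b c -> same w a c.
Proof. by move=> [W [t [_ _ ->]]]; rewrite !code_sameP => /eqP-> /eqP->. Qed.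

Lemma pull_same (T T' : Type) (u v : T' -> T) (w : code_of S T) : class_code F w ->
  (forall a, same w (u a) (v a)) -> pull u w = pull v w.
Proof.
move=> [W [t [_ _ ->]]] uv; rewrite !pull_code; apply: code_ext => a /=.
by apply/eqP; apply: uv.
Qed.

Section Swap.
Variables (k : zmodType) (mu : forall X Y, {ffun X -> Y} -> k).
Hypothesis mu_inv : iso_invariant F mu.

Lemma pull_swap_glued (T0 T1 : finType) (p : T0 -> T1) y (w : code_of S (T1 + T1)) :
  glued F p p inl inr y y w -> glued F p p inl inr y y (pull (@swap _) w).
Proof.
move=> [cw w1 w2 sw]; split; rewrite ?pull_pull //; first exact: class_code_pull.
by move=> a; apply: (same_sym (w := w)) => //; apply: sw.
Qed.

Lemma extval_comp_onto (T'' T' T : finType) (s : T'' -> T') (u : T' -> T) (w : code_of S T) :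
  onto s -> class_code F w -> extval F mu (u \o s) w = extval F mu u w.
Proof.
move=> s_onto [W [t [FW t_onto ->]]].
have [t0 [t0_onto t0E]] := onto_codom (fun a => t (u a)).
rewrite !(extval_incl mu_inv) //; congr (mu (incl _)).
apply/setP => x; apply/imsetP/imsetP => -[a _ ->]; first by exists (s a).
by have [b <-] := s_onto a; exists b.
Qed.

Lemma extval_swap (T0 T1 : finType) (p : T0 -> T1) (w : code_of S (T1 + T1)) :
  class_code F w -> (forall a, same w (inl (p a)) (inr (p a))) ->
  extval F mu (inl \o p) (pull (@swap _) w) = extval F mu (inl \o p) w.
Proof.
move=> cw sw; rewrite (extval_pull mu_inv) //; last exact: invol_onto (@swapK _).
by apply: (extval_same mu_inv) => // a; apply: (same_sym cw (sw a)).
Qed.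

Hypothesis odd_aut : forall X, F X -> odd #|automorphisms X|.

(** A code fixed by the swap would identify the two copies throughout. The map [f] allows the copies
    to be compared on a part only. *)
Lemma pull_swap_offdiagonal (T1 T2 : finType) (f : T2 -> T1) (w : code_of S (T1 + T1)) :
  class_code F w -> offdiagonal (inl \o f) (inr \o f) w ->
  offdiagonal (inl \o f) (inr \o f) (pull (@swap _) w) /\ pull (@swap _) w <> w.
Proof.
move=> cw ow; split.
  by move=> h; apply: ow => a; apply: same_sym => //; apply: h.
move=> /(pull_invol_fixed odd_aut (@swapK _) cw) h; apply: ow => a.
by apply: same_sym => //; apply: (h (inl (f a))).
Qed.

End Swap.

Section Modular.
Variables (N : int) (mu : forall X Y, {ffun X -> Y} -> int).

(** Values are integers and not residues because the doubling step squares a lift and reads the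
    result modulo [2 * N]. *)
Definition measure_mod : Prop :=
  [/\ forall X Y (i : {ffun X -> Y}), F X -> F Y -> isomorphism i -> (N %| mu i - 1)%Z,
      forall X Y Z (i : {ffun X -> Y}) (j : {ffun Y -> Z}),
        F X -> F Y -> F Z -> embedding i -> embedding j ->
        (N %| mu (compf j i) - mu j * mu i)%Z
    & forall X Y X' (i : {ffun X -> Y}) (j : {ffun X -> X'}),
        F X -> F Y -> F X' -> embedding i -> embedding j ->
        forall n (c : 'I_n -> cocone Y X'), amalgamations F i j c ->
        (N %| mu i - \sum_(a < n) mu (inX' (c a)))%Z].

Hypothesis mu_inv : iso_invariant F mu.
Hypothesis mu_measure : measure_mod.

Local Notation extval := (extval F mu).

Lemma extval_comp (T'' T' T : finType) (v : T'' -> T') (u : T' -> T) (w : code_of S T) :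
  class_code F w -> (N %| extval (u \o v) w - extval u w * extval v (pull u w))%Z.
Proof.
move=> [W [t [FW t_onto ->]]]; rewrite pull_code.
pose A : {set W} := [set t (u a) | a : T'].
pose B : {set W} := [set t (u (v a)) | a : T''].
have BA : B \subset A by apply/fintype.subsetP => x /imsetP[a _ ->]; apply/imsetP; exists (v a).
have [tA [tA_onto tAE]] := onto_codom (fun a => t (u a)).
have [tB [tB_onto tBE]] := onto_codom (fun a => t (u (v a))).
have cA : code (t \o u) = code tA.
  by rewrite -(code_emb tA (incl_emb A)); apply: code_ext => a /=; rewrite inclE tAE.
rewrite cA (extvalE mu_inv (t0 := tA) (e := incl A)) //; last 2 first.
- exact: incl_emb.
- by move=> a; rewrite inclE tAE.
rewrite (extvalE mu_inv (t0 := tB) (e := incl_sub BA)) //; last 3 first.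
- exact: F_induced.
- exact: incl_sub_emb.
- by move=> a; apply: val_inj; rewrite incl_subE tBE tAE.
rewrite (extvalE mu_inv (t0 := tB) (e := compf (incl A) (incl_sub BA))) //; last 2 first.
- by apply: comp_emb; [apply: incl_emb|apply: incl_sub_emb].
- by move=> a; rewrite compfE inclE incl_subE tBE.
case: mu_measure => _ h _; apply: h => //; try exact: F_induced.
  exact: incl_sub_emb.
exact: incl_emb.
Qed.

(** This is additivity with amalgamations replaced by codes; agreement of [y] and [x] on [T0]
    provides the common substructure. *)
Lemma base_change (T0 T1 T2 T : finType) (p : T0 -> T1) (q : T0 -> T2)
    (k1 : T1 -> T) (k2 : T2 -> T) (y : code_of S T1) (x : code_of S T2) :
  gluing p q k1 k2 -> class_code F y -> class_code F x -> pull p y = pull q x ->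
  (N %| extval p y - \sum_(w \in glued F p q k1 k2 y x) extval k2 w)%Z.
Proof.
move=> gl [Y [t1 [FY o1 ->]]] [X' [t2 [FX' o2 ->]]]; rewrite !pull_code => cE.
pose A : {set Y} := [set t1 (p a) | a : T0].
have [t0 [o0 t0E]] : exists t0 : T0 -> induced A, onto t0 /\ forall a, val (t0 a) = t1 (p a).
  exact: onto_codom.
have c0 : code t0 = code (t2 \o q).
  by rewrite -cE -(code_emb t0 (incl_emb A)); apply: code_ext => a /=; rewrite inclE t0E.
have [j [ej jE]] := code_lift o0 c0.
have it a : incl A (t0 a) = t1 (p a) by rewrite inclE t0E.
have [n [c ac]] := amalgamations_exist F_fraisse (incl A) j.
have [g [gm gE]] := sum_glued F_fraisse int gl o0 o1 o2 it jE ac.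
rewrite gE (extvalE mu_inv FY o1 o0 (incl_emb A) it).
have -> : \sum_(a < n) extval k2 (code (g a)) = \sum_(a < n) mu (inX' (c a)).
  apply: eq_bigr => a _; have [g_onto g1 g2] := gm a.
  have [Fc eX eY _ _] := let: And3 ac _ _ := ac in ac a.
  exact: (extvalE mu_inv Fc g_onto o2 eX (fun b => esym (g2 b))).
case: mu_measure => _ _ h; apply: h ac => //; first exact: F_induced.
exact: incl_emb.
Qed.

End Modular.
End ModularMeasures.

(** * Doubling the modulus of a measure *)

Section Diagonal.
Variables (S : signature) (F : struct S -> Prop).
Implicit Types X Y Z W : struct S.

(** The cocone of two identities is one of the amalgamations. Conversely, if the two maps into an
    apex agree, they are onto, so the apex is [Y] itself. *)
Lemma diagonal_index X Y (i : {ffun X -> Y}) n (c : 'I_n -> cocone Y Y) :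
  F Y -> amalgamations F i i c ->
  exists a0, isomorphism (inY (c a0)) /\
    forall a, (inY (c a) == inX' (c a)) = (a == a0).
Proof.
move=> FY [ac c_inj c_cover].
have [|a0 [h [ih hX hY]]] := c_cover (Cocone (idf Y) (idf Y)).
  split => //; try exact: iso_emb (idf_iso Y).
  by move=> z; left; apply/codomP; exists z; rewrite ffunE.
have comp_id Z (f : {ffun Y -> Z}) : compf f (idf Y) = f.
  by apply/ffunP => y; rewrite !ffunE.
rewrite /= !comp_id in hX hY.
exists a0; split=> [|a]; first by rewrite -hY.
apply/eqP/eqP => [E|->]; last by rewrite -hX -hY.
have [_ _ eY _ cover] := ac a.
have /iso_inv[g [ig gK Kg]] : isomorphism (inY (c a)).
  apply: surj_iso => // z; case: (cover z) => /codomP[y ->]; exists y => //.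
  by rewrite E.
apply: c_inj; exists (compf h g); split.
- have [hi [f fK Kf]] := ih; have [gi _] := ig.
  apply: surj_iso; first exact: comp_emb.
  by move=> y; exists (inY (c a) (f y)); rewrite compfE gK Kf.
- by apply/ffunP => y; rewrite !compfE -E gK hX.
- by apply/ffunP => y; rewrite !compfE gK hY.
Qed.

(** The diagonal amalgamation contributes [mu i]. For a measure, additivity and multiplicativity
    make the left side the square of [mu i]. *)
Lemma sum_amalgamations_self (k : zmodType) (mu : forall X Y, {ffun X -> Y} -> k)
    X Y (i : {ffun X -> Y}) n (c : 'I_n -> cocone Y Y) :
  fraisse F -> iso_invariant F mu -> F Y -> embedding i -> amalgamations F i i c ->
  \sum_(a < n) mu _ _ (compf (inX' (c a)) i) = mu _ _ i + offdiag F mu i.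
Proof.
move=> F_fraisse mu_inv FY ei ac; have [a0 [ia0 a0P]] := diagonal_index FY ac.
rewrite /offdiag (sum_offdiagonal F_fraisse mu_inv ei (gluing_sum i i)
  (@onto_id _) (@onto_id _) (fun=> erefl) ac).
rewrite (bigD1 a0) //= [in RHS](bigD1 a0) //= a0P eqxx add0r; congr (_ + _).
  have [Fc eX _ _ _] := let: And3 aa _ _ := ac in aa a0.
  apply/esym/(mu_inv _ _ _ _ _ _ (idf X) (inX' (c a0))) => //.
  - exact: comp_emb.
  - exact: idf_iso.
  - by have /eqP <- : inY (c a0) == inX' (c a0) by rewrite a0P.
  - by move=> x; rewrite !ffunE.
apply: eq_bigr => a /negPf na; rewrite a0P na.
by have [_ _ _ -> _] := let: And3 aa _ _ := ac in aa a.
Qed.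

End Diagonal.

Section Doubling.
Variables (S : signature) (F : struct S -> Prop).
Hypothesis F_fraisse : fraisse F.
Hypothesis odd_aut : forall X, F X -> odd #|automorphisms X|.
Implicit Types X Y Z W : struct S.
Variables (N : int) (mu : forall X Y, {ffun X -> Y} -> int).
Hypothesis mu_inv : iso_invariant F mu.
Hypothesis mu_measure : measure_mod F N mu.

Local Notation extval := (extval F mu).
Local Notation off := (offdiag F mu).

Lemma mu_square X Y (i : {ffun X -> Y}) : F X -> F Y -> embedding i ->
  (N %| mu i ^+ 2 - mu i - off i)%Z.
Proof.
move=> FX FY ei; have [n [c ac]] := amalgamations_exist F_fraisse i i.
have [_ mul amal] := mu_measure.
have -> : mu i ^+ 2 - mu i - off i =
    mu i * (mu i - \sum_(a < n) mu (inX' (c a))) -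
    \sum_(a < n) (mu (compf (inX' (c a)) i) - mu (inX' (c a)) * mu i).
  rewrite sumrB -mulr_suml (sum_amalgamations_self F_fraisse mu_inv FY ei ac).
  ring.
rewrite rpredB //; first by rewrite dvdz_mull // (amal _ _ _ _ _ FX FY FY ei ei _ _ ac).
apply: rpred_sum => a _; have [Fc eX _ _ _] := let: And3 ac _ _ := ac in ac a.
exact: mul.
Qed.

Lemma even_offdiag X Y (i : {ffun X -> Y}) : (2 %| off i)%Z.
Proof.
rewrite -[2]mulr1; apply: (dvdz_fsum_free_involution (s := pull (@swap _))).
- by apply: finite_setIl; apply: finite_glued.
- move=> w [gw ow]; have [cw _ _ sw] := gw.
  have [ow' wsw] := pull_swap_offdiagonal odd_aut (f := id) cw ow.
  split => //; first by split=> //; apply: pull_swap_glued.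
    exact: pull_swapK.
  exact: (extval_swap mu_inv).
- by move=> *; apply: dvd1z.
Qed.

Hypothesis even_N : (2 %| N)%Z.

(** With a_0 = mu(i) and a_1 = -D(i)/2 this is the ghost component a_0^2 + 2 a_1. By [mu_square] it
    agrees with [mu i] modulo [N]. *)
Definition doubled X Y (i : {ffun X -> Y}) : int := mu i ^+ 2 - off i.

Lemma doubled_inv : iso_invariant F doubled.
Proof.
move=> X Y X' Y' i i' g h FY FY' ei ei' ig ih E; rewrite /doubled.
by rewrite (mu_inv FY FY' ei ei' ig ih E) (offdiag_inv F_fraisse mu_inv FY FY' ei ei' ig ih E).
Qed.

(** In (a - b)(a + b) the second factor is even because [N] is; squaring thus gains the factor 2. *)
Lemma dvdz_sqr_mod (a b : int) : (N %| a - b)%Z -> (2 * N %| a ^+ 2 - b ^+ 2)%Z.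
Proof.
move=> ab; rewrite subr_sqr mulrC dvdz_mul //.
have -> : a + b = (a - b) + 2 * b by ring.
by rewrite rpredD ?dvdz_mulr // (dvdz_trans even_N).
Qed.

Lemma doubled_iso X Y (i : {ffun X -> Y}) : F X -> F Y -> isomorphism i ->
  (2 * N %| doubled i - 1)%Z.
Proof.
move=> FX FY ii; rewrite /doubled /offdiag.
set A := _ `&` _; have -> : A = set0.
  rewrite -subset0 => w [[cw _ _ sw] ow]; apply: ow => y.
  by have [x <-] := iso_onto ii y; apply: sw.
rewrite fsbig_set0 subr0 -[1](expr1n _ 2); apply: dvdz_sqr_mod.
by case: mu_measure => h _ _; apply: h.
Qed.

Definition sum_map (A A' B B' : Type) (f : A -> A') (g : B -> B') (c : A + B) : A' + B' :=
  match c with inl a => inl (f a) | inr b => inr (g b) end.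

Lemma extval_id X Y (i : {ffun X -> Y}) : F Y -> embedding i -> extval i (code id) = mu i.
Proof.
by move=> FY ei; apply: (extvalE mu_inv (t0 := id)) => //; apply: onto_id.
Qed.

Lemma code_ffun X Y (i : {ffun X -> Y}) : embedding i -> code i = code (id : X -> X).
Proof. by move=> ei; apply: (code_emb id ei). Qed.

(* Two base changes along [j], one in each summand. *)
Lemma sum_extensions Y Z (j : {ffun Y -> Z}) (v : code_of S (Y + Y)) :
  F Y -> F Z -> embedding j ->
  class_code F v -> pull inl v = code id -> pull inr v = code id ->
  (N %| mu j ^+ 2 - \sum_(w \in [set w | [/\ class_code F w, pull inl w = code id,
            pull inr w = code id & pull (sum_map j j) w = v]])
        extval (sum_map j j) w)%Z.
Proof.
move=> FY FZ ej cv vl vr.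
have cZ : class_code F (code (id : Z -> Z)) by exists Z, id; split => //; apply: onto_id.
pose k2 : Y + Y -> Z + Y := sum_map j id.
pose k2' : Z + Y -> Z + Z := sum_map id j.
have gl1 : gluing j (inl : Y -> Y + Y)%type (inl : Z -> Z + Y)%type k2.
  split; first by case=> a; [left|right]; [exists a|exists (inr a)].
  move=> W f1 f2 E; exists (fun c => match c with inl a => f1 a | inr b => f2 (inr b) end).
  by split => //; case=> a //=.
have gl2 : gluing j (inr : Y -> Z + Y)%type (inr : Z -> Z + Z)%type k2'.
  split; first by case=> a; [right|left]; [exists (inl a)|exists a].
  move=> W f1 f2 E; exists (fun c => match c with inr a => f1 a | inl b => f2 (inl b) end).
  by split => //; case=> a //=.
set E := [set w | _].
pose G1 := glued F j inl inl k2 (code id) v.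
have fG1 : finite_set G1 by apply: finite_glued.
have G1P V : G1 V -> [/\ class_code F V, pull inl V = code id,
    pull inr V = code id & pull k2 V = v].
  move=> [cV Vl Vv _]; split => //.
  by rewrite -vr -Vv pull_pull.
have b1 := base_change F_fraisse mu_inv mu_measure gl1 cZ cv.
rewrite -/G1 pull_code vl (extval_id FZ ej) in b1.
have {}b1 := b1 (code_ffun ej).
have b2 V : G1 V -> (N %| mu j - \sum_(w \in E `&` pull k2' @^-1` [set V]) extval k2' w)%Z.
  move=> GV; have [cV Vl Vr Vv] := G1P _ GV.
  have := base_change F_fraisse mu_inv mu_measure gl2 cZ cV.
  rewrite pull_code Vr (extval_id FZ ej) => /(_ (code_ffun ej)).
  congr (N %| _ - _)%Z; apply: eq_fsbigl; apply/seteqP; split => w.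
    move=> [cw wr wV sw]; split => //; split => //.
      by rewrite -Vl -wV pull_pull.
    by rewrite -Vv -wV pull_pull; congr pull; apply/funext; case.
  move=> [[cw wl wr wv] /= wV]; split => // a.
  have [W [t [_ _ ->]]] := cw; by rewrite code_sameP.
have fE : finite_set E by apply: sub_finite_set (finite_class_code F_fraisse _) => w [].
have EG w : E w -> G1 (pull k2' w).
  move=> [cw wl wr wv]; split.
  - exact: class_code_pull.
  - by rewrite pull_pull -wl.
  - by rewrite pull_pull -wv; congr pull; apply/funext; case.
  - move=> a; have [W [t [_ _ ->]]] := cw; by rewrite pull_code code_sameP.
rewrite (fsum_fibers _ fE fG1 EG).
(* An exact identity: modulo [N] its three parts vanish by the first base change, by the second one,
   and by multiplicativity. *)
have -> : mu j ^+ 2 - \sum_(V \in G1)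
     \sum_(w \in E `&` pull k2' @^-1` [set V]) extval (sum_map j j) w =
   mu j * (mu j - \sum_(V \in G1) extval k2 V) +
   \sum_(V \in G1) (extval k2 V * (mu j - \sum_(w \in E `&` pull k2' @^-1` [set V]) extval k2' w))
   - \sum_(V \in G1) \sum_(w \in E `&` pull k2' @^-1` [set V])
       (extval (sum_map j j) w - extval k2' w * extval k2 (pull k2' w)).
  have -> : \sum_(V \in G1) (extval k2 V *
        (mu j - \sum_(w \in E `&` pull k2' @^-1` [set V]) extval k2' w)) =
      mu j * \sum_(V \in G1) extval k2 V - \sum_(V \in G1) (extval k2 V *
        \sum_(w \in E `&` pull k2' @^-1` [set V]) extval k2' w).
    by rewrite mulr_fsumr -fsumB //; apply: eq_fsbigr => V _; ring.
  have -> : \sum_(V \in G1) \sum_(w \in E `&` pull k2' @^-1` [set V])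
        (extval (sum_map j j) w - extval k2' w * extval k2 (pull k2' w)) =
      \sum_(V \in G1) \sum_(w \in E `&` pull k2' @^-1` [set V]) extval (sum_map j j) w
      - \sum_(V \in G1) (extval k2 V *
        \sum_(w \in E `&` pull k2' @^-1` [set V]) extval k2' w).
    rewrite -fsumB //; apply: eq_fsbigr => V _.
    rewrite fsumB; last exact: finite_setIl.
    congr (_ - _); rewrite mulr_fsumr; apply: eq_fsbigr => w /set_mem[_ /= ->].
    exact: mulrC.
  ring.
rewrite rpredB ?rpredD //; first by rewrite dvdz_mull.
  by apply: dvdz_fsum => // V GV; rewrite dvdz_mull // b2.
apply: dvdz_fsum => // V GV; apply: dvdz_fsum; first exact: finite_setIl.
move=> w [[cw _ _ _] _].
have := extval_comp F_fraisse mu_inv mu_measure k2 k2' cw.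
congr (N %| extval _ _ - _)%Z; by apply/funext; case.
Qed.

End Doubling.

(** * Multiplicativity modulo 2N *)

Section Doubling.
Variables (S : signature) (F : struct S -> Prop).
Hypothesis F_fraisse : fraisse F.
Hypothesis odd_aut : forall X, F X -> odd #|automorphisms X|.
Implicit Types X Y Z W : struct S.
Variables (N : int) (mu : forall X Y, {ffun X -> Y} -> int).
Hypothesis mu_inv : iso_invariant F mu.
Hypothesis mu_measure : measure_mod F N mu.
Hypothesis even_N : (2 %| N)%Z.

Local Notation extval := (extval F mu).
Local Notation off := (offdiag F mu).
Local Notation dbl := (doubled F mu).

Lemma dvdz_fsum_swap (T : finType) (A : set (code_of S (T + T)))
    (f : code_of S (T + T) -> int) d :
  finite_set A ->
  (forall w, A w -> [/\ A (pull (@swap _) w), pull (@swap _) w <> w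
    & f (pull (@swap _) w) = f w]) ->
  (forall w, A w -> (d %| f w)%Z) -> (2 * d %| \sum_(w \in A) f w)%Z.
Proof.
move=> fA As; apply: dvdz_fsum_free_involution (pull (@swap _)) _ _ fA _.
by move=> w /As[? ? ?]; split => //; apply: pull_swapK.
Qed.

(** Off-diagonal amalgamations of [Z] with itself over [X] split by whether the two copies of [Y]
    agree. If they do, they are amalgamations over [Y] and give D(j) mu(i). If not, they lie above
    an off-diagonal amalgamation of [Y] with itself, and each fibre contributes mu(j)^2. The errors
    are multiples of [N], invariant under the free swap. *)
Lemma offdiag_comp X Y Z (i : {ffun X -> Y}) (j : {ffun Y -> Z}) :
  F X -> F Y -> F Z -> embedding i -> embedding j ->
  (2 * N %| off (compf j i) - (off j * mu i + mu j ^+ 2 * off i))%Z.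
Proof.
move=> FX FY FZ ei ej.
have cjiE : (compf j i : X -> Z) = j \o i by apply/funext => x; rewrite compfE.
pose O1 := offdiagonal (S := S) (inl : Z -> Z + Z)%type inr.
pose O2 := offdiagonal (S := S) (inl \o j : Y -> Z + Z)%type (inr \o j).
pose G := glued F (j \o i) (j \o i) (inl : Z -> Z + Z)%type inr (code id) (code id).
have O21 : O2 `<=` O1 by move=> w o2 o1; apply: o2 => y; apply: o1.
have fG : finite_set G by apply: finite_glued.
have offE : off (compf j i) = \sum_(w \in G `&` O2) extval (inl \o (j \o i)) w
    + \sum_(w \in (G `&` O1) `\` O2) extval (inl \o (j \o i)) w.
  rewrite /offdiag cjiE (@fsum_split _ _ _ O2); last exact: finite_setIl.
  by congr (_ + _); apply: eq_fsbigl; rewrite -setIA; congr (_ `&` _); apply/setIidPr.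
(* The copies of [Y] agree: multiplicativity applies term by term. *)
have part1 : (2 * N %| \sum_(w \in (G `&` O1) `\` O2) extval (inl \o (j \o i)) w -
    off j * mu i)%Z.
  pose H := glued F j j (inl : Z -> Z + Z)%type inr (code id) (code id) `&` O1.
  have -> : (G `&` O1) `\` O2 = H.
    apply/seteqP; split => w.
      move=> [[[cw wl wr sw] o1] /contrapT o2]; split => //; split => //.
    move=> [[cw wl wr sw] o1]; split; last by apply.
    by split => //; split => // x; apply: sw.
  have fH : finite_set H by apply: finite_setIl; apply: finite_glued.
  rewrite /offdiag mulr_fsuml -fsumB //.
  apply: dvdz_fsum_swap => // w [[cw wl wr sw] o1].
    have [o1' wsw] := pull_swap_offdiagonal odd_aut (f := id) cw o1.
    split => //; first by split=> //; apply: pull_swap_glued.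
    rewrite (extval_swap mu_inv (p := j)) // (extval_swap mu_inv (p := j \o i)) // => x.
    exact: sw.
  have := extval_comp F_fraisse mu_inv mu_measure i (inl \o j) cw.
  by rewrite -pull_pull wl pull_code (code_ffun ej) (extval_id mu_inv).
pose V := glued F i i (inl : Y -> Y + Y)%type inr (code id) (code id) `&`
  offdiagonal (S := S) (inl : Y -> Y + Y)%type inr.
have fV : finite_set V by apply: finite_setIl; apply: finite_glued.
pose jj := sum_map j j.
have jj_swap : jj \o @swap Y = @swap Z \o jj by apply/funext; case.
have pull_jj w : pull jj (pull (@swap _) w) = pull (@swap _) (pull jj w).
  by rewrite !pull_pull jj_swap.
have GV w : (G `&` O2) w -> V (pull jj w).
  move=> [[cw wl wr sw] o2]; split; last by [].
  split; [exact: class_code_pull| | |exact: sw].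
    by rewrite pull_pull -[jj \o inl]/(inl \o j) -pull_pull wl pull_code (code_ffun ej).
  by rewrite pull_pull -[jj \o inr]/(inr \o j) -pull_pull wr pull_code (code_ffun ej).
(* The copies of [Y] differ: each value factors through the substructure that they generate. *)
have part2 : (2 * N %| \sum_(w \in G `&` O2) extval (inl \o (j \o i)) w -
    \sum_(w \in G `&` O2) (extval jj w * extval (inl \o i) (pull jj w)))%Z.
  rewrite -fsumB; last exact: finite_setIl.
  apply: dvdz_fsum_swap; first exact: finite_setIl.
    move=> w Gw; have [[cw wl wr sw] o2] := Gw.
    have [o2' wsw] := pull_swap_offdiagonal odd_aut cw o2.
    split => //; first by split=> //; apply: pull_swap_glued.
    rewrite (extval_swap mu_inv (p := j \o i)) // pull_jj.
    have [[cv _ _ sv] _] := GV _ Gw.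
    rewrite (extval_swap mu_inv (p := i)) //; congr (_ - _ * _).
    rewrite (extval_pull mu_inv) //; last exact: invol_onto (@swapK _).
    by rewrite -jj_swap (extval_comp_onto mu_inv) //; apply: invol_onto (@swapK _).
  by move=> w [[cw _ _ _] _]; apply: (extval_comp F_fraisse mu_inv mu_measure (inl \o i) jj cw).
have fib v : V v -> (G `&` O2) `&` pull jj @^-1` [set v] =
    [set w | [/\ class_code F w, pull inl w = code id,
            pull inr w = code id & pull jj w = v]].
  move=> [[cv vl vr sv] ov]; apply/seteqP; split => w; first by move=> [[[cw wl wr sw] o2] /= wv].
  move=> [cw wl wr wv]; split => //; split; first split => //.
    by move=> x; move: (sv x); rewrite -wv.
  by move=> h; apply: ov; rewrite -wv.
(* Grouping by that substructure [v], the fibre sum is [mu j ^+ 2] modulo [N] by [sum_extensions];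
   the swap now pairs the fibres. *)
have part3 : (2 * N %| \sum_(w \in G `&` O2) (extval jj w * extval (inl \o i) (pull jj w)) -
   mu j ^+ 2 * off i)%Z.
  rewrite (fsum_fibers _ (finite_setIl _ fG) fV GV) mulr_fsumr -fsumB //.
  pose Q v := \sum_(w \in G `&` O2 `&` pull jj @^-1` [set v]) extval jj w.
  rewrite (eq_fsbigr (fun v => (Q v - mu j ^+ 2) * extval (inl \o i) v)); last first.
    move=> v _; rewrite mulrBl; congr (_ - _); rewrite /Q mulr_fsuml.
    by apply: eq_fsbigr => w /set_mem[_ /= ->].
  apply: dvdz_fsum_swap => // v Vv; have [[cv vl vr sv] ov] := Vv.
    have [ov' vsv] := pull_swap_offdiagonal odd_aut (f := id) cv ov.
    have Vv' : V (pull (@swap _) v) by split=> //; apply: pull_swap_glued.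
    split => //; rewrite (extval_swap mu_inv) //; congr ((_ - _) * _).
    rewrite /Q !fib //.
    rewrite (reindex_fsbig (pull (@swap _)) [set w | [/\ class_code F w, pull inl w = code id,
            pull inr w = code id & pull jj w = v]]).
      apply: eq_fsbigr => w /set_mem[cw _ _ _].
      rewrite (extval_pull mu_inv) //; last exact: invol_onto (@swapK _).
      by rewrite -jj_swap (extval_comp_onto mu_inv) //; apply: invol_onto (@swapK _).
    split.
    - move=> w [cw wl wr wv]; split; first exact: class_code_pull.
      + by rewrite pull_pull.
      + by rewrite pull_pull.
      + by rewrite pull_jj wv.
    - by move=> w w' _ _ /(congr1 (pull (@swap _))); rewrite !pull_swapK.
    - move=> w [cw wl wr wv]; exists (pull (@swap _) w); last exact: pull_swapK.
      split; first exact: class_code_pull.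
      + by rewrite pull_pull.
      + by rewrite pull_pull.
      + by rewrite pull_jj wv pull_swapK.
  rewrite dvdz_mulr // -rpredN opprB /Q fib //.
  exact: (sum_extensions F_fraisse mu_inv mu_measure).
rewrite offE.
have := rpredD (rpredD part1 part2) part3.
by congr (_ %| _)%Z; ring.
Qed.

Lemma doubled_comp X Y Z (i : {ffun X -> Y}) (j : {ffun Y -> Z}) :
  F X -> F Y -> F Z -> embedding i -> embedding j ->
  (2 * N %| dbl (compf j i) - dbl j * dbl i)%Z.
Proof.
move=> FX FY FZ ei ej.
have [_ mul _] := mu_measure.
have sq := dvdz_sqr_mod even_N (mul _ _ _ _ _ FX FY FZ ei ej).
have oc := offdiag_comp FX FY FZ ei ej.
(* D(j) supplies the factor 2 and the other factor is divisible by [N]. *)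
have ev : (2 * N %| off j * (mu i ^+ 2 - mu i - off i))%Z.
  by apply: dvdz_mul; [apply: even_offdiag|apply: mu_square].
have -> : dbl (compf j i) - dbl j * dbl i =
   (mu (compf j i) ^+ 2 - (mu j * mu i) ^+ 2)
   - (off (compf j i) - (off j * mu i + mu j ^+ 2 * off i))
   + off j * (mu i ^+ 2 - mu i - off i).
  by rewrite /doubled; ring.
by rewrite rpredD // rpredB.
Qed.

End Doubling.

(** * Additivity modulo 2N *)

Section Doubling.
Variables (S : signature) (F : struct S -> Prop).
Hypothesis F_fraisse : fraisse F.
Hypothesis odd_aut : forall X, F X -> odd #|automorphisms X|.
Implicit Types X Y Z W : struct S.
Variables (N : int) (mu : forall X Y, {ffun X -> Y} -> int).
Hypothesis mu_inv : iso_invariant F mu.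
Hypothesis mu_measure : measure_mod F N mu.
Hypothesis even_N : (2 %| N)%Z.

Local Notation extval := (extval F mu).
Local Notation off := (offdiag F mu).
Local Notation dbl := (doubled F mu).

Section Amalgams.
Variables (X Y X' : struct S) (i : {ffun X -> Y}) (j : {ffun X -> X'}).
Hypotheses (FX : F X) (FY : F Y) (FX' : F X') (ei : embedding i) (ej : embedding j).
Variables (n : nat) (c : 'I_n -> cocone Y X').
Hypothesis ac : amalgamations F i j c.

Let T : finType := ((Y + Y) + X')%type.
Let a1 : Y + X' -> T := sum_map inl id.
Let a2 : Y + X' -> T := sum_map inr id.
Let sw : T -> T := sum_map (@swap Y) id.

(** Codes of structures generated by [X'] and two distinct copies of [Y], each copy forming with
    [X'] an amalgamation over [X]. Such triples are counted in two ways: by what the two copies of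
    [Y] generate, and by the pair of amalgamations with [X']. *)
Let E : set (code_of S T) := [set w |
  [/\ class_code F w, pull a1 w \in glued F i j inl inr (code id) (code id),
      pull a2 w \in glued F i j inl inr (code id) (code id)
    & ~ forall y, same w (inl (inl y)) (inl (inr y))]].

Let fE : finite_set E.
Proof. by apply: sub_finite_set (finite_class_code F_fraisse _) => w []. Qed.

Let pull_sw1 (w : code_of S T) : pull a1 (pull sw w) = pull a2 w.
Proof. by rewrite pull_pull; congr pull; apply/funext; case. Qed.

Let pull_sw2 (w : code_of S T) : pull a2 (pull sw w) = pull a1 w.
Proof. by rewrite pull_pull; congr pull; apply/funext; case. Qed.

Let sw_onto : onto sw.
Proof.
by apply: invol_onto; case=> [[]|].
Qed.

Let pull_swK (w : code_of S T) : pull sw (pull sw w) = w.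
Proof.
by rewrite pull_pull -[RHS]pull_id; congr pull; apply/funext; case=> [[]|].
Qed.

Let E_sw w : E w -> E (pull sw w).
Proof.
move=> [cw w1 w2 ow]; split; rewrite ?pull_sw1 ?pull_sw2 //; first exact: class_code_pull.
by move=> h; apply: ow => y; exact: (same_sym cw (h y)).
Qed.

Let extval_sw w : class_code F w -> extval inr (pull sw w) = extval inr w.
Proof. by move=> cw; rewrite (extval_pull mu_inv). Qed.

(** Base change along [j] expands the value of each off-diagonal amalgamation of [Y] with itself
    into the triples above it, modulo [N]; the swap pairs the errors. *)
Lemma offdiag_triple : (2 * N %| off i - \sum_(w \in E) extval inr w)%Z.
Proof.
pose V := glued F i i (inl : Y -> Y + Y)%type inr (code id) (code id) `&`
  offdiagonal (S := S) (inl : Y -> Y + Y)%type inr.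
have fV : finite_set V by apply: finite_setIl; apply: finite_glued.
have EV w : E w -> V (pull inl w).
  move=> [cw /set_mem[_ w1 wr s1] /set_mem[_ w2 _ s2] ow]; split => //.
  split; first exact: class_code_pull.
  - by rewrite -w1 !pull_pull.
  - by rewrite -w2 !pull_pull.
  - by move=> x; exact: (same_trans cw (s1 x) (same_sym cw (s2 x))).
pose H v := \sum_(w \in E `&` pull inl @^-1` [set v]) extval inr w.
rewrite (fsum_fibers _ fE fV EV) -fsumB //.
apply: dvdz_fsum_swap => // v Vv; have [[cv vl vr sv] ov] := Vv.
  have [ov' vsv] := pull_swap_offdiagonal odd_aut (f := id) cv ov.
  split => //; first by split=> //; apply: pull_swap_glued.
  rewrite (extval_swap mu_inv) //; congr (_ - _).
  rewrite (reindex_fsbig (pull sw) (E `&` pull inl @^-1` [set v])).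
    by apply: eq_fsbigr => w /set_mem[[cw _ _ _] _]; apply: extval_sw.
  have inl_sw w : pull inl (pull sw w) = pull (@swap _) (pull inl w) by rewrite !pull_pull.
  split.
  - by move=> w [Ew /= <-]; split; [apply: E_sw|apply: inl_sw].
  - by move=> w w' _ _ /(congr1 (pull sw)); rewrite !pull_swK.
  - move=> w [Ew /= wv]; exists (pull sw w); last exact: pull_swK.
    by split; [apply: E_sw|rewrite /= inl_sw wv pull_swapK].
have cX' : class_code F (code (id : X' -> X')) by exists X', id; split => //; apply: onto_id.
have := base_change F_fraisse mu_inv mu_measure (gluing_sum (inl \o i) j) cv cX'.
have -> : pull (inl \o i) v = pull j (code id).
  by rewrite -pull_pull vl !pull_code !code_ffun.
move=> /(_ erefl); congr (_ %| _ - _)%Z; apply: eq_fsbigl; apply/seteqP; split => w.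
  move=> [cw wl wr s1]; split => //; split => //; last by move=> h; apply: ov; rewrite -wl.
    apply/mem_set; split; [exact: class_code_pull| | |exact: s1].
      by rewrite -vl -wl !pull_pull.
    by rewrite -wr !pull_pull.
  apply/mem_set; split; [exact: class_code_pull| | |].
  - by rewrite -vr -wl !pull_pull.
  - by rewrite -wr !pull_pull.
  - move=> x; have svx : same w (inl (inl (i x))) (inl (inr (i x))).
      by move: (sv x); rewrite -wl.
    exact: (same_trans cw (same_sym cw svx) (s1 x)).
move=> [[cw /set_mem[_ w1 wr s1] /set_mem[_ w2 _ s2] ow] /= wv]; split => //.
by rewrite -wr !pull_pull.
Qed.

Let K (al be : code_of S (Y + X')) : int :=
  \sum_(w \in E `&` pull a1 @^-1` [set al] `&` pull a2 @^-1` [set be]) extval inr w.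

Let K_sym al be : K al be = K be al.
Proof.
rewrite /K (reindex_fsbig (pull sw) (E `&` pull a1 @^-1` [set be] `&` pull a2 @^-1` [set al])).
  by apply: eq_fsbigr => w /set_mem[[[cw _ _ _] _] _]; apply: extval_sw.
split.
- move=> w [[Ew /= w1] /= w2]; split; last by rewrite /= pull_sw2.
  by split; [apply: E_sw|rewrite /= pull_sw1].
- by move=> w w' _ _ /(congr1 (pull sw)); rewrite !pull_swK.
- move=> w [[Ew /= w1] /= w2]; exists (pull sw w); last exact: pull_swK.
  split; last by rewrite /= pull_sw2.
  by split; [apply: E_sw|rewrite /= pull_sw1].
Qed.

Let glue_a : gluing (inr : X' -> Y + X')%type (inr : X' -> Y + X')%type a1 a2.
Proof.
split; first by case=> [[y|y]|x]; [left; exists (inl y)|right; exists (inl y)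
  |right; exists (inr x)].
move=> W f1 f2 f12; exists (fun z => match z with inl (inl y) => f1 (inl y)
  | inl (inr y) => f2 (inl y) | inr x => f2 (inr x) end).
by split; case=> a //=.
Qed.

Let EK al be : glued F i j inl inr (code id) (code id) al ->
  glued F i j inl inr (code id) (code id) be ->
  E `&` pull a1 @^-1` [set al] `&` pull a2 @^-1` [set be] =
  glued F inr inr a1 a2 al be `&` offdiagonal a1 a2.
Proof.
move=> gal gbe; apply/seteqP; split => w.
  move=> [[[cw w1 w2 ow] /= wa] /= wb]; split; last first.
    by move=> h; apply: ow => y; apply: (h (inl y)).
  split => // x; have [W [t [_ _ ->]]] := cw; by rewrite code_sameP.
move=> [[cw wa wb _] ow]; split => //; split => //; split; rewrite ?wa ?wb; try exact/mem_set.
  by [].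
move=> h; apply: ow => -[y|x]; first exact: h.
have [W [t [_ _ ->]]] := cw; by rewrite code_sameP.
Qed.

(** Different restrictions force the two copies of [Y] to differ, so the triples are all
    amalgamations over [X'] of the structures coded by [al] and [be]; additivity and
    multiplicativity evaluate their sum. *)
Lemma triple_offdiag_pairs al be : al != be ->
  glued F i j inl inr (code id) (code id) al ->
  glued F i j inl inr (code id) (code id) be ->
  (N %| K al be - extval inr al * extval inr be)%Z.
Proof.
move=> nab gal gbe; have [cal _ ar _] := gal; have [cbe _ br _] := gbe.
have -> : K al be = \sum_(w \in glued F inr inr a1 a2 al be) extval inr w.
  apply: eq_fsbigl; rewrite EK //; apply: setIidl => w [cw wa wb _] h.
  by move/eqP: nab; apply; rewrite -wa -wb; apply: (pull_same cw h).
have bc := base_change F_fraisse mu_inv mu_measure glue_a cal cbe (etrans ar (esym br)).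
set G := glued F inr inr a1 a2 al be in bc *.
have -> : \sum_(w \in G) extval inr w - extval inr al * extval inr be =
   \sum_(w \in G) (extval inr w - extval a2 w * extval inr (pull a2 w))
   - (extval inr al - \sum_(w \in G) extval a2 w) * extval inr be.
  have -> : \sum_(w \in G) (extval inr w - extval a2 w * extval inr (pull a2 w)) =
    \sum_(w \in G) extval inr w - (\sum_(w \in G) extval a2 w) * extval inr be.
    rewrite mulr_fsuml -fsumB; last exact: finite_glued.
    by apply: eq_fsbigr => w /set_mem[_ _ -> _].
  ring.
apply: rpredB; last exact: dvdz_mulr.
apply: dvdz_fsum; first exact: finite_glued.
by move=> w [cw _ _ _]; apply: (extval_comp F_fraisse mu_inv mu_measure inr a2 cw).
Qed.

(** D(i) is the double sum of K(a,b) modulo [2 * N]. The terms with a = b are exactly the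
    off-diagonal sums of the maps [inX' (c a)]; the others match the cross terms in the square of
    the sum of [mu (inX' (c a))] modulo [N], and modulo [2 * N] once (a,b) is paired with (b,a). *)
Lemma doubled_amalgamations :
  (2 * N %| dbl i - \sum_(a < n) dbl (inX' (c a)))%Z.
Proof.
have oX : onto (id : X -> X) by apply: onto_id.
have oY : onto (id : Y -> Y) by apply: onto_id.
have oX' : onto (id : X' -> X') by apply: onto_id.
have [g [gm gE]] := sum_glued F_fraisse int (gluing_sum i j) oX oY oX'
  (fun=> erefl) (fun=> erefl) ac.
pose B := glued F i j (inl : Y -> Y + X')%type inr (code id) (code id).
have fB : finite_set B by apply: finite_glued.
have cB a : B (code (g a)).
  have [aa _ _] := ac.
  exact: (@glue_map_code _ _ F_fraisse _ _ _ _ i j inl inr _ _ _ i j id id id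
    (fun=> erefl) (fun=> erefl) _ _ (aa a) (gm a)).
have g_inj a b : code (g a) = code (g b) -> a = b.
  have [aa c_inj _] := ac => gab; apply: c_inj.
  exact: (glue_map_iso oY oX' (aa a) (aa b) (gm a) (gm b) gab).
have mE a : extval inr (code (g a)) = mu (inX' (c a)).
  have [Fc eX _ _ _] := let: And3 aa _ _ := ac in aa a.
  have [g_onto _ g2] := gm a.
  exact: (extvalE mu_inv Fc g_onto oX' eX (fun b => esym (g2 b))).
(* Two distinct copies of [Y] with the same restriction make an off-diagonal amalgamation of [c a]
   with itself over [X']. *)
have KE a : K (code (g a)) (code (g a)) = off (inX' (c a)).
  have [Fc eX _ _ _] := let: And3 aa _ _ := ac in aa a.
  have [g_onto _ g2] := gm a.
  rewrite (offdiag_glued F_fraisse mu_inv eX glue_a oX' g_onto (fun b => esym (g2 b))).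
  rewrite /K EK; [|exact: cB|exact: cB]. by [].
have EE : \sum_(w \in E) extval inr w = \sum_(a < n) \sum_(b < n) K (code (g a)) (code (g b)).
  rewrite (@fsum_fibers _ _ _ E B (pull a1)) // ?gE; last by move=> w [_ /set_mem].
  apply: eq_bigr => a _.
  rewrite (@fsum_fibers _ _ _ _ B (pull a2)) // ?gE; first exact: finite_setIl.
  by move=> w [[_ _ /set_mem]].
have ot := offdiag_triple; rewrite EE in ot.
have [_ _ amal] := mu_measure.
have sq := dvdz_sqr_mod even_N (amal _ _ _ _ _ FX FY FX' ei ej _ _ ac).
have pairs : (2 * N %| \sum_(a < n) \sum_(b < n | b != a)
    (K (code (g a)) (code (g b)) - mu (inX' (c a)) * mu (inX' (c b))))%Z.
  apply: dvdz_sum_symmetric => a b; first by rewrite K_sym mulrC.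
  move=> nab; rewrite -!mE; apply: (triple_offdiag_pairs _ (cB a) (cB b)).
  by apply: contra_neq nab => /g_inj.
have := rpredB (rpredB sq ot) pairs; congr (_ %| _)%Z.
have s1 : \sum_(a < n) \sum_(b < n) K (code (g a)) (code (g b)) =
  \sum_(a < n) off (inX' (c a)) +
  \sum_(a < n) \sum_(b < n | b != a) K (code (g a)) (code (g b)).
  by rewrite -big_split; apply: eq_bigr => a _; rewrite (bigD1 a) //= KE.
have s2 : (\sum_(a < n) mu (inX' (c a))) ^+ 2 =
  \sum_(a < n) mu (inX' (c a)) ^+ 2 +
  \sum_(a < n) \sum_(b < n | b != a) mu (inX' (c a)) * mu (inX' (c b)).
  rewrite expr2 mulr_suml -big_split; apply: eq_bigr => a _.
  by rewrite mulr_sumr (bigD1 a).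
have s3 : \sum_(a < n) \sum_(b < n | b != a)
     (K (code (g a)) (code (g b)) - mu (inX' (c a)) * mu (inX' (c b))) =
  \sum_(a < n) \sum_(b < n | b != a) K (code (g a)) (code (g b)) -
  \sum_(a < n) \sum_(b < n | b != a) mu (inX' (c a)) * mu (inX' (c b)).
  by rewrite -sumrB; apply: eq_bigr => a _; rewrite sumrB.
by rewrite s1 s2 s3 /doubled sumrB; ring.
Qed.

End Amalgams.

Lemma doubled_measure : measure_mod F (2 * N) dbl.
Proof.
split.
- by move=> *; apply: doubled_iso.
- by move=> *; apply: doubled_comp.
- by move=> X Y Y1 i j FX FY FY1 ei ej n c ac; apply: (doubled_amalgamations FX FY FY1 ei ej ac).
Qed.

End Doubling.

(** * Generation by minimal marked structures *)

Section Generators.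
Variables (S : signature) (F : struct S -> Prop).
Hypothesis F_fraisse : fraisse F.
Implicit Types X Y Z W : struct S.

Lemma card_induced X (A : {set X}) : #|induced A| = #|A|.
Proof. by rewrite card_sig; apply: eq_card => x; rewrite inE. Qed.

Lemma card_iso X Y (f : {ffun X -> Y}) : isomorphism f -> #|X| = #|Y|.
Proof. by move=> [_ bf]; apply: bij_eq_card bf. Qed.

Section Measure.
Variables (k : comNzRingType) (mu : forall X Y, {ffun X -> Y} -> k).
Hypothesis mu_measure : measure F mu.

Lemma measure_iso_invariant : iso_invariant F mu.
Proof.
move=> X Y X' Y' i i' g h FY FY' ei ei' ig ih E.
have [m1 mM _] := mu_measure.
have FX : F X by apply: hereditary FY ei.
have FX' : F X' by apply: hereditary FY' ei'.
have : mu (compf h i) = mu (compf i' g).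
  by congr mu; apply/ffunP => x; rewrite !compfE.
rewrite !mM //; try exact: iso_emb.
by rewrite (m1 _ _ h) // (m1 _ _ g) // mul1r mulr1.
Qed.

Definition marked_value (M : marked S) : k := mu (incl (~: [set mark M])).

(* Deleting a point separated from the mark does not change the value. *)
Lemma minimal_marked_value (M : marked S) : F M ->
  exists M0 : marked S, minimal_marked F M0 /\ marked_value M = marked_value M0.
Proof.
have [n] := ubnP #|M|; elim: n M => // n IH M; rewrite ltnS => sM FM.
have [nex|[y [yx sep]]] : (forall y : M, ~ extraneous F y) \/ exists y : M, extraneous F y.
- by have [h|/forallNP h] := pselect (exists y : M, extraneous F y); [right|left].
- by exists M.
have [_ am uniq_am] := sep.
set A : {set M} := [set y]%SET in am uniq_am.
set B : {set M} := [set mark M]%SET in am uniq_am.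
set i := incl_sub (compl_subl A B) in am uniq_am.
set j := incl_sub (compl_subr A B) in am uniq_am.
have FA : F (induced (~: A)) by apply: F_induced.
have FB : F (induced (~: B)) by apply: F_induced.
have FAB : F (induced (~: (A :|: B))) by apply: F_induced.
have ei : embedding i by apply: incl_sub_emb.
have ej : embedding j by apply: incl_sub_emb.
(* Separation leaves a single term in the additivity formula. *)
have E : marked_value M = mu i.
  have [_ _ amal] := mu_measure.
  rewrite (amal _ _ _ i j FAB FA FB ei ej 1%N (fun=> Cocone (incl (~: B)) (incl (~: A)))).
    by rewrite big_ord_recl big_ord0 addr0.
  by split => // [a b _|d /uniq_am]; [rewrite !ord1|exists ord0].
have xA : mark M \in ~: A by rewrite !inE eq_sym.
pose M' := Marked (exist (fun x => x \in ~: A) (mark M) xA : induced (~: A)).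
have [|//|M0 [minM0 M'E]] := IH M'.
  rewrite card_induced; apply: leq_trans sM.
  by rewrite -(cardsC A) cards1.
exists M0; split => //; rewrite -M'E E.
have [|g [eg gE]] := corestrict (A := ~: [set mark M']) ei.
  move=> u; rewrite !inE; apply/negP => /eqP/(congr1 val); rewrite incl_subE /= => ux.
  by have := valP u; rewrite /= ux !inE eqxx orbT.
apply: (measure_iso_invariant (g := g) (h := idf _)) => //.
- exact: incl_emb.
- apply: surj_iso => // v.
  have vAB : val (val v) \in ~: (A :|: B).
    have := valP v; have := valP (val v); rewrite /= !inE negb_or => -> /= vx.
    by apply: contra vx => /eqP vx; apply/eqP/val_inj.
  exists (exist _ (val (val v)) vAB); apply: val_inj; rewrite gE.
  by apply: val_inj; rewrite incl_subE.
- exact: idf_iso.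
- by move=> u; rewrite ffunE inclE gE.
Qed.

Lemma finite_marked_values :
  finitely_many_classes (minimal_marked F) (@marked_iso S) ->
  exists l : seq k,
    (forall M : marked S, F M -> marked_value M \in l) /\
    (forall v, v \in l -> exists M : marked S, F M /\ v = marked_value M).
Proof.
move=> [n [s hs]].
(* Representatives may lie outside the class. Keeping only those isomorphic to a minimal marked
   structure makes every listed value a value of the measure on the class. *)
pose P (a : 'I_n) := `[< exists2 M, minimal_marked F M & marked_iso M (s a) >].
have iso_value (M M' : marked S) : F M -> marked_iso M M' ->
    F M' /\ marked_value M = marked_value M'.
  move=> FM [f if_ fx]; have [f' [if' fK f'K]] := iso_inv if_.
  have FM' : F M' by apply: hereditary FM (iso_emb if').
  split => //.
  have [||g [eg gE]] := corestrict (f := compf f (incl (~: [set mark M]))) (A := ~: [set mark M']).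
  - by apply: comp_emb; [apply: iso_emb|apply: incl_emb].
  - move=> u; rewrite compfE inclE !inE -fx (inj_eq (emb_inj (iso_emb if_))).
    by have := valP u; rewrite !inE.
  apply: (measure_iso_invariant (g := g) (h := f)) => //; try exact: incl_emb.
    apply: surj_iso => // v.
    have vM : f' (val v) \in ~: [set mark M].
      rewrite !inE; apply/negP => /eqP vx.
      have : val v != mark M' by have := valP v; rewrite /= !inE.
      by move/eqP; apply; rewrite -[LHS]f'K vx.
    exists (exist (fun x => x \in ~: [set mark M]%SET) _ vM); apply: val_inj.
    rewrite gE compfE inclE /=.
    exact: f'K.
  by move=> u; rewrite !inclE gE compfE inclE.
exists [seq marked_value (s a) | a <- enum P]; split.
- move=> M /minimal_marked_value[M0 [minM0 ->]].
  have [a Ma] := hs _ minM0.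
  have [_ ->] := iso_value _ _ (proj1 minM0) Ma.
  apply: map_f; rewrite mem_enum; apply/asboolP; by exists M0.
- move=> v /mapP[a]; rewrite mem_enum => /asboolP[M minM Ma] ->.
  by exists (s a); split => //; have [] := iso_value _ _ (proj1 minM) Ma.
Qed.

(** Points outside the image are removed one at a time, with one factor each. The number of factors
    is recorded for the valuation estimate. *)
Lemma measure_prod (l : seq k) :
  (forall M : marked S, F M -> marked_value M \in l) ->
  forall X Y (i : {ffun X -> Y}), F Y -> embedding i ->
  exists s : seq k, [/\ {subset s <= l}, (size s + #|X|)%N = #|Y|
    & mu i = \prod_(x <- s) x].
Proof.
move=> lP X Y; have [n] := ubnP #|Y|; elim: n Y => // n IH Y; rewrite ltnS => sY i FY ei.
have [m1 mM _] := mu_measure.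
have FX := hereditary F_fraisse FY ei.
have [h|] := pselect (forall y, exists x, i x = y).
  exists [::]; have ii := surj_iso ei h; split => //.
    exact: card_iso ii.
  by rewrite big_nil; apply: m1.
move=> /existsNP[y yi]; pose M := Marked y.
have [|g [eg gE]] := corestrict (A := ~: [set y]) ei.
  by move=> x; rewrite !inE; apply/negP => /eqP xy; apply: yi; exists x.
have FM : F (induced (~: [set y])) by apply: F_induced.
have cY : #|Y| = #|induced (~: [set y])|.+1.
  by rewrite card_induced -(cardsC [set y]) cards1.
have [|//|//|s [sl ss sE]] := IH (induced (~: [set y])) _ g.
  by rewrite -cY.
exists (marked_value M :: s); split.
- by move=> x; rewrite inE => /predU1P[->|/sl //]; apply: lP.
- by rewrite cY -ss.
- rewrite big_cons -sE -mM //; last exact: incl_emb.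
  by congr mu; apply/ffunP => x; rewrite compfE inclE gE.
Qed.

End Measure.

(** Values are lifted to [A] as products of lifts of the generators. The axioms hold after [e],
    hence after [phi], which kills the kernel of [e]; taking [phi] nonzero on the product of all
    generators makes every value nonzero. *)
Lemma specialize_measure (L : idomainType) (C : numClosedFieldType)
    (mu : forall X Y, {ffun X -> Y} -> L) :
  (forall z : int, z%:~R = 0 :> L -> z = 0) ->
  finitely_many_classes (minimal_marked F) (@marked_iso S) ->
  measure F mu ->
  (forall X Y (i : {ffun X -> Y}), F X -> F Y -> embedding i -> mu X Y i != 0) ->
  exists nu : forall X Y, {ffun X -> Y} -> C, measure F nu /\ regular F nu.
Proof.
move=> char0 fin mu_measure mu0.
have [l [lP lM]] := finite_marked_values mu_measure fin.
have l0 x : x \in l -> x != 0.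
  by move=> /lM[M [FM ->]]; apply: mu0 => //; [apply: F_induced|apply: incl_emb].
have [A [e [lift se]]] := specialization C l char0.
have /choice[f fE] : forall x, exists a, x \in l -> e a = x.
  by move=> x; have [/lift[a aE]|] := boolP (x \in l); [exists a|exists 0].
have prodE s : {subset s <= l} -> e (\prod_(x <- s) f x) = \prod_(x <- s) x.
  by move=> sl; rewrite rmorph_prod big_seq [RHS]big_seq; apply: eq_bigr => x /sl/fE.
have [|phi [kphi]] := se (\prod_(x <- l) f x).
  by rewrite prodE // prodf_seq_neq0; apply/allP => x /l0.
rewrite rmorph_prod prodf_seq_neq0 => /allP phil.
have H X Y (i : {ffun X -> Y}) : exists a, F Y -> embedding i -> e a = mu X Y i /\ phi a != 0.
  have [[FY ei]|h] := pselect (F Y /\ embedding i); last first.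
    by exists 0 => FY ei; case: h.
  have [s [sl _ sE]] := measure_prod mu_measure lP FY ei.
  exists (\prod_(x <- s) f x) => _ _; split; first by rewrite prodE.
  by rewrite rmorph_prod prodf_seq_neq0; apply/allP => x /sl/phil.
pose lft X Y (i : {ffun X -> Y}) := projT1 (cid (H X Y i)).
have lftP X Y (i : {ffun X -> Y}) : F Y -> embedding i ->
    e (lft X Y i) = mu X Y i /\ phi (lft X Y i) != 0.
  by rewrite /lft; case: cid.
have [m1 mM mA] := mu_measure.
exists (fun X Y i => phi (lft X Y i)); split; last first.
  by move=> X Y i FX FY ei; rewrite unitfE; case: (lftP _ _ i FY ei).
split.
- move=> X Y i FX FY ii; apply/eqP; rewrite -subr_eq0 -(rmorph1 phi) -rmorphB.
  apply/eqP/kphi; rewrite rmorphB rmorph1 (lftP _ _ i FY (iso_emb ii)).1.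
  by rewrite m1 // subrr.
- move=> X Y Z i j FX FY FZ ei ej; apply/eqP; rewrite -subr_eq0 -rmorphM -rmorphB.
  apply/eqP/kphi; rewrite rmorphB rmorphM.
  rewrite (lftP _ _ _ FZ (comp_emb ej ei)).1 (lftP _ _ j FZ ej).1 (lftP _ _ i FY ei).1.
  by rewrite mM // subrr.
- move=> X Y X' i j FX FY FX' ei ej n c ac; apply/eqP.
  rewrite -subr_eq0 -rmorph_sum -rmorphB; apply/eqP/kphi.
  rewrite rmorphB rmorph_sum (lftP _ _ i FY ei).1 (mA _ _ _ _ _ FX FY FX' ei ej _ _ ac).
  apply/eqP; rewrite subr_eq0; apply/eqP; apply: eq_bigr => a _.
  have [Fc eX _ _ _] := let: And3 aa _ _ := ac in aa a.
  by rewrite (lftP _ _ _ Fc eX).1.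
Qed.

End Generators.

(** * Regular measures and odd classes *)

Section RegularOdd.
Variables (S : signature) (F : struct S -> Prop).
Hypothesis F_fraisse : fraisse F.
Hypothesis odd_aut : forall X, F X -> odd #|automorphisms X|.
Hypothesis fin : finitely_many_classes (minimal_marked F) (@marked_iso S).
Implicit Types X Y Z W : struct S.
Variables (K : numFieldType) (mu : forall X Y, {ffun X -> Y} -> K).
Hypothesis mu_measure : measure F mu.
Hypothesis mu_neq0 : forall X Y (i : {ffun X -> Y}), F X -> F Y -> embedding i -> mu i != 0.

(** Inclusion-exclusion: the two copies of [Y] cover the apex and share the image of [X]. For a
    one-point extension the apex thus adds at most two points to [X]. *)
Lemma self_amalgamation_card X Y (i : {ffun X -> Y}) (c : cocone Y Y) :
  embedding i -> amalgamation F i i c -> (#|c| + #|X| <= #|Y| + #|Y|)%N.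
Proof.
move=> ei [_ eX eY comm cover].
pose U := [set inX' c y | y : Y]%SET; pose V := [set inY c y | y : Y]%SET.
have cU : #|U| = #|Y| by rewrite card_imset //; apply: emb_inj.
have cV : #|V| = #|Y| by rewrite card_imset //; apply: emb_inj.
rewrite -{1}cU -{1}cV -cardsUI leq_add //.
  rewrite -cardsT subset_leq_card //; apply/fintype.subsetP => z _.
  by rewrite inE; case: (cover z) => /codomP[y ->]; rewrite imset_f ?orbT.
rewrite -(card_imset X (inj_comp (emb_inj eX) (emb_inj ei))) subset_leq_card //.
apply/fintype.subsetP => _ /imsetP[x _ ->]; rewrite inE /= imset_f //=.
by rewrite -compfE comm compfE imset_f.
Qed.

(** The list [d] contains one amalgamation from each orbit of the swap off the diagonal. *)
Lemma offdiag_half X Y (i : {ffun X -> Y}) : F X -> F Y -> embedding i ->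
  exists m (d : 'I_m -> cocone Y Y), (forall a, amalgamation F i i (d a)) /\
    mu i ^+ 2 - mu i = 2 * \sum_(a < m) mu (compf (inY (d a)) i).
Proof.
move=> FX FY ei.
have mu_inv := measure_iso_invariant F_fraisse mu_measure.
have [n [c ac]] := amalgamations_exist F_fraisse i i.
have [m1 mM mA] := mu_measure.
have -> : mu i ^+ 2 - mu i = offdiag F mu i.
  apply/eqP; rewrite subr_eq addrC; apply/eqP.
  rewrite -(sum_amalgamations_self F_fraisse mu_inv FY ei ac) expr2.
  rewrite {1}(mA _ _ _ _ _ FX FY FY ei ei _ _ ac) mulr_suml; apply: eq_bigr => a _.
  by have [Fc eX _ _ _] := let: And3 aa _ _ := ac in aa a; rewrite mM.
have [|w [gw ow]|r [rA E]] := fsum_free_involution (s := pull (@swap _))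
  (f := extval F mu (inl \o i))
  (A := glued F i i (inl : Y -> Y + Y)%type inr (code id) (code id) `&` offdiagonal inl inr).
- by apply: finite_setIl; apply: finite_glued.
- have [cw _ _ sw] := gw.
  have [ow' wsw] := pull_swap_offdiagonal odd_aut (f := id) cw ow.
  split => //; first by split=> //; apply: pull_swap_glued.
    exact: pull_swapK.
  exact: (extval_swap mu_inv).
have realize w : exists d : cocone Y Y, w \in r ->
    amalgamation F i i d /\ extval F mu (inl \o i) w = mu (compf (inY d) i).
  have [/rA[gw _]|] := boolP (w \in r); last by exists (Cocone (idf Y) (idf Y)).
  have [d [g [ad [g_onto g1 g2] <-]]] := @glued_cocone _ _ _ _ _ _ _ _ _ _ _ _ _ i i id id id
    (gluing_sum i i) (@onto_id _) (@onto_id _) (@onto_id _) (fun=> erefl) (fun=> erefl) _ gw.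
  exists d => _; split => //; have [Fd _ eY _ _] := ad.
  apply: (extvalE mu_inv (t0 := id)) => //; first exact: onto_id.
    exact: comp_emb.
  by move=> x; rewrite compfE /= g1.
have /choice[d dP] := realize.
exists (size r), (fun a => d (tnth (in_tuple r) a)); split.
  by move=> a; have [] := dP _ (mem_tnth a (in_tuple r)).
rewrite /offdiag E -[_ *+ 2]mulr_natl big_tnth; congr (_ * _).
by apply: eq_bigr => a _; have [] := dP _ (mem_tnth a (in_tuple r)).
Qed.

Section Valuation.
Variable A : set K.
Hypotheses (sA : is_subring A) (A_half : ~ A 2^-1) (A_val : forall x, A x \/ A x^-1)
  (A_unit : forall s, A s -> A (1 - 2 * s)^-1).

Lemma minimal_valuation (l : seq K) x : x \in l -> (forall y, y \in l -> y != 0) ->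
  exists2 z, z \in l & forall y, y \in l -> A (y / z).
Proof.
have [A1 AB AM] := sA.
elim: l x => // y l IH x _ l0.
have y0 : y != 0 by apply: l0; rewrite mem_head.
have [l_nil|[x' x'l]] : l = [::] \/ exists x', x' \in l.
- by case: l {IH l0} => [|x' l]; [left|right; exists x'; rewrite mem_head].
- exists y; first by rewrite mem_head.
  by move=> t; rewrite l_nil inE => /eqP->; rewrite divff.
have [|z zl zmin] := IH x' x'l; first by move=> t tl; apply: l0; rewrite inE tl orbT.
have z0 : z != 0 by apply: l0; rewrite inE zl orbT.
have [yz|zy] := A_val (y / z).
  exists z; first by rewrite inE zl orbT.
  by move=> t; rewrite inE => /predU1P[->|/zmin].
exists y; first by rewrite mem_head.
move=> t; rewrite inE => /predU1P[->|/zmin tz]; first by rewrite divff.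
have -> : t / y = (t / z) * (y / z)^-1 by rewrite invf_div mulrA divfK.
exact: AM.
Qed.

Lemma measure_integral X Y (i : {ffun X -> Y}) : F Y -> embedding i -> A (mu i).
Proof.
have [A1 AB AM] := sA.
have [l [lP lM]] := finite_marked_values F_fraisse mu_measure fin.
suff lA x : x \in l -> A x.
  move=> FY ei; have [s [sl _ ->]] := measure_prod F_fraisse mu_measure lP FY ei.
  by apply: is_subring_prod => // x /sl/lA.
have l0 y : y \in l -> y != 0.
  by move=> /lM[M [FM ->]]; apply: mu_neq0 => //; [apply: F_induced|apply: incl_emb].
move=> xl; have [z zl zmin] := minimal_valuation xl l0.
have z0 := l0 _ zl.
suff Az : A z.
  by rewrite -[x](divfK z0); apply: (AM _ _) => //; apply: zmin.
have [//|AzV] := A_val z.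
have [M [FM zE]] := lM _ zl.
set Y1 := marked_struct M in FM; set X1 := induced (~: [set mark M]%SET).
have ei := incl_emb (~: [set mark M]%SET).
have FX1 : F X1 by apply: F_induced.
have cX1 : #|Y1| = #|X1|.+1 by rewrite card_induced -(cardsC [set mark M]%SET) cards1.
have [m [d [ad E]]] := offdiag_half FX1 FM ei.
rewrite -/(marked_value mu M) -zE in E.
(* Dividing the quadratic identity for [z] by [z ^+ 2] gives 1/z = 1 - 2s, so it suffices that [s]
   lies in [A]. *)
pose s := (\sum_(a < m) mu (compf (inY (d a)) (incl (~: [set mark M]%SET)))) / z ^+ 2.
have zV : z^-1 = 1 - 2 * s.
  rewrite /s mulrA -E mulrBl divff ?expf_neq0 // opprB addrCA subrr addr0.
  by rewrite expr2 invfM mulrA divff // mul1r.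
rewrite -[z]invrK zV; apply: A_unit.
rewrite /s mulr_suml; apply: is_subring_sum => // a _.
have [Fd _ eY _ _] := ad a.
have [t [tl ts ->]] := measure_prod F_fraisse mu_measure lP Fd (comp_emb eY ei).
have st : (size t <= 2)%N.
  have := self_amalgamation_card ei (ad a); rewrite -ts -/X1 -/Y1 cX1; lia.
(* Products of fewer than two generators are padded by powers of 1/z, which lies in [A] in the case
   at hand. *)
have -> : (\prod_(x <- t) x) / z ^+ 2 = (\prod_(x <- t) (x / z)) * z^-1 ^+ (2 - size t).
  rewrite big_split /= -[in LHS](subnKC st) exprD invfM mulrA; congr (_ * _).
    by rewrite big_const_seq count_predT iter_mulr_1 exprVn.
  by rewrite exprVn.
apply: (AM _ _); last exact: is_subringX.
rewrite -(big_map (fun x => x / z) xpredT id); apply: is_subring_prod => //.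
by move=> _ /mapP[x' /tl/zmin ? ->].
Qed.

Lemma measure_odd X Y (i : {ffun X -> Y}) : F X -> F Y -> embedding i ->
  exists2 s, A s & mu i = 1 + 2 * s.
Proof.
move=> FX FY ei; have [m [d [ad E]]] := offdiag_half FX FY ei.
have [m1 mM mA] := mu_measure; have i0 := mu_neq0 FX FY ei.
exists (\sum_(a < m) mu (inY (d a))).
  apply: is_subring_sum => // a _; have [Fd _ eY _ _] := ad a.
  exact: measure_integral.
apply: (mulIf i0); rewrite mulrDl mul1r -mulrA mulr_suml.
rewrite [in RHS](eq_bigr (fun a => mu (compf (inY (d a)) i))).
  by rewrite -E expr2 addrC subrK.
by move=> a _; have [Fd _ eY _ _] := ad a; rewrite mM.
Qed.

Lemma regular_odd : odd_class F.
Proof.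
have [A1 AB AM] := sA.
move=> X Y Z i j FX FY FZ ei ej.
have [n [c ac]] := amalgamations_exist F_fraisse i j.
exists n, c; split => //; have [m1 mM mA] := mu_measure.
have [s As E] := measure_odd FX FY ei.
have /choice[t tP] : forall a, exists t, A t /\ mu (inX' (c a)) = 1 + 2 * t.
  move=> a; have [Fc eX _ _ _] := let: And3 aa _ _ := ac in aa a.
  by have [t At tE] := measure_odd FZ Fc eX; exists t.
have {E} : 1 + 2 * s = n%:R + 2 * \sum_(a < n) t a.
  rewrite -E (mA _ _ _ _ _ FX FY FZ ei ej _ _ ac) mulr_sumr.
  rewrite (eq_bigr (fun a => 1 + 2 * t a)); last by move=> a _; have [] := tP a.
  by rewrite big_split /= sumr_const card_ord.
move=> E; apply: contraT => even_n; case: A_half.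
(* For even [n], halving the identity expresses 1/2 by elements of [A]. *)
have -> : 2^-1 = n./2%:R + \sum_(a < n) t a - s.
  apply: (mulfI (_ : 2 != 0)); first by rewrite pnatr_eq0.
  rewrite mulfV ?pnatr_eq0 // !mulrDr mulrN -natrM mul2n.
  have -> : (n./2).*2 = n by rewrite -[RHS]odd_double_half (negPf even_n).
  by rewrite -E addrK.
apply: AB => //; apply: is_subringD => //.
  by elim: (n./2) => [|q IH]; [apply: is_subring0|rewrite mulrSr; apply: is_subringD].
by apply: is_subring_sum => // a _; case: (tP a).
Qed.

End Valuation.
End RegularOdd.

Section OddRegular.
Variables (S : signature) (F : struct S -> Prop).
Hypothesis F_fraisse : fraisse F.
Hypothesis odd_aut : forall X, F X -> odd #|automorphisms X|.
Hypothesis F_odd : odd_class F.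
Implicit Types X Y Z W : struct S.

Fixpoint approximation (n : nat) : forall X Y, {ffun X -> Y} -> int :=
  if n is n'.+1 then doubled F (approximation n') else fun _ _ _ => 1.

(** Oddness is given for some list of representatives; every other list has the same length, since
    both count the same set of codes. *)
Lemma odd_amalgamations X Y Z (i : {ffun X -> Y}) (j : {ffun X -> Z}) n c :
  F X -> F Y -> F Z -> embedding i -> embedding j ->
  amalgamations F i j (n := n) c -> odd n.
Proof.
move=> FX FY FZ ei ej ac; have [n' [c' [ac' odd_n']]] := F_odd FX FY FZ ei ej.
have count m (d : 'I_m -> cocone Y Z) : amalgamations F i j d ->
    \sum_(w \in glued F i j (inl : Y -> Y + Z)%type inr (code id) (code id)) (1 : int) = m%:R.
  move=> ad; have [g [_ ->]] := sum_glued F_fraisse int (gluing_sum i j)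
    (@onto_id _) (@onto_id _) (@onto_id _) (fun=> erefl) (fun=> erefl) ad.
  by rewrite sumr_const card_ord.
have := count _ _ ac; rewrite (count _ _ ac') => /eqP.
by rewrite eqr_nat => /eqP <-.
Qed.

Lemma approximation_measure n :
  iso_invariant F (approximation n) /\ measure_mod F (2 ^+ n.+1) (approximation n).
Proof.
elim: n => [|n [inv_n meas_n]].
  split; first by [].
  split => [X Y i _ _ _|X Y Z i j _ _ _ _ _|X Y X' i j FX FY FX' ei ej n c ac].
  - by rewrite subrr dvdz0.
  - by rewrite mulr1 subrr dvdz0.
  - have := odd_amalgamations FX FY FX' ei ej ac.
    rewrite sumr_const card_ord expr1 => odd_n.
    rewrite -(odd_double_half n) odd_n natrD opprD addrA subrr sub0r rpredN.
    by rewrite -muln2 natrM dvdz_mull.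
split; first exact: doubled_inv.
rewrite exprS; apply: doubled_measure => //.
by rewrite exprS dvdz_mulr.
Qed.

Lemma approximation_odd n X Y (i : {ffun X -> Y}) : ~~ (2 %| approximation n i)%Z.
Proof.
elim: n => [//|n IH] /=; rewrite /doubled rpredBr; last first.
  exact: (even_offdiag F_fraisse odd_aut (proj1 (approximation_measure n))).
by move: IH; rewrite -![_ \in _]/(2 %| _)%Z !dvdzE abszX Euclid_dvdX // andbT.
Qed.

Lemma odd_regular (C : numClosedFieldType) :
  finitely_many_classes (minimal_marked F) (@marked_iso S) ->
  exists nu : forall X Y, {ffun X -> Y} -> C, measure F nu /\ regular F nu.
Proof.
move=> fin; have [L [lim [lim0 lim_odd char0]]] := two_adic_limit.
pose mu X Y (i : {ffun X -> Y}) : L := lim (fun n => approximation n i).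
have limE f g : (forall n, (2 ^+ n.+1 %| f n - g n)%Z) -> lim f = lim g.
  move=> fg; apply/eqP; rewrite -subr_eq0 -rmorphB; apply/eqP/lim0 => n.
  by apply: dvdz_trans (fg n); apply: dvdz_exp2l.
apply: (specialize_measure F_fraisse C (mu := mu)) => //; last first.
  move=> X Y i _ _ _; apply: lim_odd => n; exact: approximation_odd.
split.
- move=> X Y i FX FY ii; rewrite -(rmorph1 lim); apply: limE => n.
  by have [_ [h _ _]] := approximation_measure n; apply: h.
- move=> X Y Z i j FX FY FZ ei ej; rewrite -rmorphM; apply: limE => n.
  by have [_ [_ h _]] := approximation_measure n; apply: h.
- move=> X Y X' i j FX FY FX' ei ej n c ac; rewrite -rmorph_sum; apply: limE => q.
  have [_ [_ _ h]] := approximation_measure q.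
  by rewrite fct_sumE; apply: (h _ _ _ _ _ FX FY FX' ei ej _ _ ac).
Qed.

End OddRegular.

Local Close Scope ring_scope.
Local Close Scope classical_set_scope.

Theorem theorem1p2 (R : realType) (S : signature) (F : struct S -> Prop) (m : nat) :
  fraisse F -> odd m ->
  finitely_many_classes (minimal_marked F) (@marked_iso S) ->
  (forall X : struct S, F X -> exists e : nat, #|automorphisms X| %| m ^ e) ->
  (exists mu : forall X Y : struct S, {ffun X -> Y} -> complex R,
      measure F mu /\ regular F mu)
  <-> odd_class F.
Proof.
move=> F_fraisse odd_m fin aut_m.
have odd_aut X : F X -> odd #|automorphisms X|.
  by move=> /aut_m[e /dvdn_odd]; apply; rewrite oddX odd_m orbT.
split=> [[mu [mu_measure mu_reg]]|F_odd]; last exact: odd_regular.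
have [A [sA A_half A_val A_unit]] := valuation_subring (complex R).
apply: (regular_odd F_fraisse odd_aut fin mu_measure _ sA A_half A_val A_unit).
by move=> X Y i FX FY ei; have := mu_reg _ _ i FX FY ei; rewrite unitfE.
Qed.
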